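(* Let $\sigma>0$, let $\Theta\subseteq\mathbb R$ be a closed interval, and let $\theta$ be drawn from a prior distribution on $\Theta$ that is absolutely continuous with respect to Lebesgue measure, with density $\pi(\theta)$. Let $\widehat\theta_n$ be any estimator of $\theta$ in the adaptive one-bit setting described in the context. Assume that the density of the prior converges to zero at the endpoints of the interval $\Theta$. Then $$\mathbb E\left[(\theta-\widehat\theta_n)^2\right]\ \ge\ \frac{\pi\sigma^2}{2n+\pi\sigma^2 I_0}\ =\ \frac{\pi}{2n}\sigma^2+O(n^{-2}),$$ where $$I_0=\mathbb E\left(\frac{d}{d\theta}\log\pi(\theta)\right)^2$$ is the Fisher information with respect to a location model in $\theta$. In the displayed bound $\pi=3.14\ldots$ is the numerical constant, whereas in the definition of $I_0$ the symbol $\pi(\theta)$ is the prior density.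
   Context: Adaptive one-bit setting: $\theta$ is drawn once from the prior. Given $\theta$, the samples $X_1,\dots,X_n$ are independent, each distributed $\mathcal N(\theta,\sigma^2)$. For each $i=1,\dots,n$ the $i$th message $M_i\in\{-1,1\}$ is a measurable function of the sample $X_i$ and of the previous messages $M_1,\dots,M_{i-1}$. The estimator $\widehat\theta_n$ is a function of $(M_1,\dots,M_n)$ only. The message functions and the estimator are otherwise arbitrary. The expectation in the mean squared error is over both the samples and the prior distribution of $\theta$; the expectation in $I_0$ is over the prior distribution of $\theta$. $O(n^{-2})$ is as $n\to\infty$.
   Formalization: The prior density is additionally assumed absolutely continuous on compact subintervals of the interior of Θ (without this the bound fails, e.g. for step densities), and the O(n^{-2}) expansion is stated only for finite I_0 (the bound is 0 when I_0 is infinite). *)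

(* Defs.v *)
From HB Require Import structures.
From mathcomp Require Import all_boot all_order all_algebra.
From mathcomp Require Import all_classical all_reals all_analysis.

Set Implicit Arguments.
Unset Strict Implicit.
Unset Printing Implicit Defensive.

Import Order.TTheory GRing.Theory Num.Theory.
Import numFieldNormedType.Exports.

Local Open Scope classical_set_scope.
Local Open Scope ring_scope.

Section Prior.
Context {R : realType}.

Record is_density_on (Theta : set R)
    (prior : probability (measurableTypeR R) R) (dens : R -> R) : Prop := {
  density_measurable : measurable_fun Theta dens ;
  density_ge0 : forall t, Theta t -> 0 <= dens t ;
  densityE : forall B : set R, measurable B ->
    prior B = (\int[lebesgue_measure]_(t in B `&` Theta) (dens t)%:E)%E }.

Definition absolutely_continuous (a b : R) (f : R -> R) : Prop :=
  forall e : R, 0 < e -> exists2 d : R, 0 < d &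
    forall (n : nat) (l r : 'I_n -> R),
      (forall i, a <= l i /\ l i <= r i /\ r i <= b) ->
      trivIset [set: 'I_n] (fun i => `]l i, r i[%classic) ->
      \sum_(i < n) (r i - l i) < d ->
      \sum_(i < n) `|f (r i) - f (l i)| < e.

Definition locally_absolutely_continuous (Theta : set R) (f : R -> R) : Prop :=
  forall a b : R, `[a, b]%classic `<=` interior Theta ->
    absolutely_continuous a b f.

(* For a closed interval, the points of Theta outside its interior are exactly
   its finite endpoints; nothing is required at an infinite end. *)
Definition vanishes_at_endpoints (Theta : set R) (f : R -> R) : Prop :=
  forall e : R, (Theta `\` interior Theta) e ->
    f x @[x --> within (interior Theta) (nbhs e)] --> (0 : R).

(* May be +oo. The derivative is only meaningful at points of the interior of
   the parameter interval where dens is positive and differentiable; under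
   local absolute continuity these carry the whole mass of the prior. *)
Definition fisher_location (prior : probability (measurableTypeR R) R)
    (dens : R -> R) : \bar R :=
  (\int[prior]_t (derive1 (fun u => ln (dens u)) t ^+ 2)%:E)%E.

End Prior.

Section OneBit.
Context {R : realType} {d : measure_display} {T : measurableType d}.
Variables (P : probability T R) (n : nat).

(* The product formula says that the kernel t |-> N(t, sigma^2)^{(x) n} is a
   regular conditional distribution of (X_1, .., X_n) given theta; the second
   parameter of normal_prob is the standard deviation. *)
Definition cond_iid_normal (sigma : R) (theta : {RV P >-> R})
    (X : 'I_n -> {RV P >-> R}) : Prop :=
  forall (B : set R) (A : 'I_n -> set R),
    measurable B -> (forall i, measurable (A i)) ->
    P (theta @^-1` B `&` \bigcap_(i in [set: 'I_n]) (X i @^-1` A i)) =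
    (\int[distribution P theta]_(t in B)
       \prod_(i < n) normal_prob t sigma (A i))%E.

(* Messages are booleans: true stands for 1 and false for -1. As there are
   finitely many histories, joint measurability of an encoder amounts to
   measurability in the sample for each history. *)
Definition adaptive_messages (X : 'I_n -> {RV P >-> R})
    (M : 'I_n -> T -> bool) : Prop :=
  forall i : 'I_n, exists2 enc : i.-tuple bool -> R -> bool,
    (forall h, measurable_fun [set: R] (enc h)) &
    forall w, M i w =
      enc [tuple M (widen_ord (ltnW (ltn_ord i)) j) w | j < i] (X i w).

Record adaptive_one_bit (prior : probability (measurableTypeR R) R)
    (sigma : R) (theta : {RV P >-> R}) (X : 'I_n -> {RV P >-> R})
    (M : 'I_n -> T -> bool) : Prop := {
  theta_prior : forall B : set R, measurable B ->
    distribution P theta B = prior B ;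
  samples_normal : cond_iid_normal sigma theta X ;
  messages_adaptive : adaptive_messages X M }.

Definition mean_squared_error (theta : {RV P >-> R}) (M : 'I_n -> T -> bool)
    (est : n.-tuple bool -> R) : \bar R :=
  ('E_P[fun w => ((theta w - est [tuple M i w | i < n]) ^+ 2)%R])%E.

End OneBit.

(* Division in \bar R, so that the bound is 0 when I0 = +oo. *)
Definition one_bit_bound {R : realType} (sigma : R) (I0 : \bar R) (n : nat)
    : \bar R :=
  ((pi * sigma ^+ 2)%:E /
   ((2 * n%:R)%:E + (pi * sigma ^+ 2)%:E * I0))%E.

(* Main.v *)
(* The bound is van Trees' inequality for the transcript of messages.  A single
   bit with acceptance set A has conditional probability q(t) = N(t, sigma^2)(A),
   and q'^2 <= 2 / (pi sigma^2) q (1 - q): among all A, the half-line {x > c}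
   maximises q' - (c - t) / sigma^2 q, and c is optimised using
   (2 Phi(z) - 1)^2 <= 1 - exp(- z^2).  Conditioning on the history, the
   transcript therefore has Fisher information at most 2 n / (pi sigma^2).
   For each transcript m of likelihood L_m, the function (t - est m) p(t) L_m(t)
   tends to 0 along suitable sequences at both ends, so its derivative
   integrates to 0; completing a square in this identity and summing over m
   gives the inequality.  The fundamental theorem of calculus for the absolutely
   continuous p comes from applying the Radon-Nikodym theorem to the
   Lebesgue-Stieltjes measures of its variation functions. *)
Require Import Defs.
From HB Require Import structures.
From mathcomp Require Import all_boot all_order all_algebra.
From mathcomp Require Import finmap.
From mathcomp Require Import all_classical all_reals all_analysis.
From mathcomp Require Import measurable_realfun.
From mathcomp Require Import ring lra.
Import Order.TTheory GRing.Theory Num.Theory.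
Import numFieldNormedType.Exports.
Local Open Scope classical_set_scope.
Local Open Scope ring_scope.
Set Implicit Arguments.
Unset Strict Implicit.
Unset Printing Implicit Defensive.

(** Two obstacles shape the proof. The interval may be unbounded and the density is only locally
    absolutely continuous, so [(t - est m) p L_m] need not tend to 0 at infinity; integrability of
    [p L_m] only provides points arbitrarily far out where it is small, and these become the limits
    of integration. Moreover, the integrand of the Fisher information has no known measurability, so
    it is compared with a measurable [g] that is almost everywhere the derivative of the extended
    density and vanishes where that density does. Since [x / 0 = 0], squared scores then make sense
    also where the likelihood is zero.

    The completed square carries one constant weight [lam = 1 / (J + K)], with [J] the information
    of [g] and [K = 2 n / (pi sigma^2)]. It minimises [lam^2 (J + K) - 2 lam], and the minimum
    [- 1 / (J + K)] is the bound. Adaptivity is felt only in the likelihood: once a transcript is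
    fixed, all acceptance sets are fixed, and the event that it occurs is a rectangle in the
    samples. *)

Section AbsolutelyContinuous.
Context {R : realType}.
Implicit Types (a b x y : R) (f h : R -> R) (p q : R * R) (s : seq (R * R)).
Local Notation mu := (@lebesgue_measure R).

(** * Absolute continuity over finite families of intervals, and total variation *)

Definition apart p q := (p.2 <= q.1) || (q.2 <= p.1).

Definition subitv p q := [&& p.1 <= q.1, q.1 <= q.2 & q.2 <= p.2].

Definition packing a b s := all (subitv (a, b)) s && pairwise apart s.

(** Sequences of pairs can be refined by concatenation, and the final inequality is weak so that it
    survives suprema over partitions. *)
Definition seq_abs_cont a b f := forall e : R, 0 < e -> exists2 d : R, 0 < d &
  forall s, packing a b s -> \sum_(p <- s) (p.2 - p.1) < d ->
    \sum_(p <- s) `|f p.2 - f p.1| <= e.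

Lemma absolutely_continuous_seq a b f :
  absolutely_continuous a b f -> seq_abs_cont a b f.
Proof.
move=> fac e e0; have [d d0 fd] := fac e e0; exists d => // s /andP[/allP sab sap] sd.
pose l (i : 'I_(size s)) := (nth (0, 0) s i).1.
pose r (i : 'I_(size s)) := (nth (0, 0) s i).2.
have := fd _ l r; rewrite !(big_nth (0, 0)) !big_mkord in sd *.
have lr i : a <= l i /\ l i <= r i /\ r i <= b.
  by have /and3P[-> -> ->] := sab _ (mem_nth (0, 0) (ltn_ord i)).
move=> H; apply/ltW/H => //.
move=> i j _ _ [x []] /=; rewrite !in_itv/= => /andP[lix xri] /andP[ljx xrj].
apply/val_inj/eqP/negPn/negP => ij.
have {}ij : (i < j)%N || (j < i)%N by rewrite -neq_ltn.
have xx k m : k < x -> x < m -> m <= k -> False by move=> ? ? ?; lra.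
move/(pairwiseP (0, 0)) : sap => sap; case/orP: ij => ij.
  have /orP[] := sap _ _ (ltn_ord i) (ltn_ord j) ij => h.
    exact: xx ljx xri h.
  exact: xx lix xrj h.
have /orP[] := sap _ _ (ltn_ord j) (ltn_ord i) ij => h.
  exact: xx lix xrj h.
exact: xx ljx xri h.
Qed.

Fixpoint cuts x (t : seq R) : seq (R * R) :=
  if t is y :: t' then (x, y) :: cuts y t' else [::].

Lemma cuts_sub x y t : itv_partition x y t -> all (subitv (x, y)) (cuts x t).
Proof.
elim: t x => // z t ih x xyt; have zyt := itv_partition_cons xyt.
have xz : x < z by case: xyt => /= /andP[].
have zy := itv_partition_le zyt; rewrite /= /subitv/= lexx (ltW xz) zy/=.
apply: sub_all (ih _ zyt) => p /and3P[/= zp p12 py].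
by rewrite /subitv/= p12 py (le_trans (ltW xz) zp).
Qed.

Lemma cuts_apart x y t : itv_partition x y t -> pairwise apart (cuts x t).
Proof.
elim: t x => // z t ih x xyt; have zyt := itv_partition_cons xyt.
rewrite /= (ih _ zyt) andbT; apply: sub_all (cuts_sub zyt) => p /and3P[/= zp _ _].
by rewrite /apart/= zp.
Qed.

Lemma variation_cuts x y f t : itv_partition x y t ->
  variation x y f t = \sum_(p <- cuts x t) `|f p.2 - f p.1|.
Proof.
move=> /variation_zip ->; elim: t x => [|z t ih] x; first by rewrite /= !big_nil.
by rewrite /= !big_cons/= ih.
Qed.

Lemma length_cuts x y t : itv_partition x y t ->
  \sum_(p <- cuts x t) (p.2 - p.1) = y - x.
Proof.
elim: t x => [|z t ih] x xyt; first by rewrite (itv_partition_nil xyt) big_nil subrr.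
by rewrite /= big_cons/= (ih _ (itv_partition_cons xyt)); ring.
Qed.

Lemma apart_sub p q r : subitv p q -> apart r p -> apart r q.
Proof.
move=> /and3P[p1 q12 q2] /orP[h|h]; apply/orP; [left|right].
  exact: le_trans h p1.
exact: le_trans q2 h.
Qed.

Lemma apartC p q : apart p q = apart q p. Proof. exact: orbC. Qed.

Lemma packing_refine a b s1 s2 p t : packing a b (s2 ++ p :: s1) ->
  itv_partition p.1 p.2 t -> packing a b ((s2 ++ cuts p.1 t) ++ s1).
Proof.
move=> /andP[]; rewrite all_cat/= => /and3P[abs2 abp abs1].
rewrite pairwise_cat/= allrel_consr => /and3P[/andP[s2p s2s1] ps2 /andP[ps1 prs1]] pt.
have tp := cuts_sub pt; rewrite /packing !all_cat abs2 abs1 andbT/=; apply/andP; split.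
  apply: sub_all tp => q /and3P[/= pq q12 qp]; move/and3P: abp => /= [ap _ pb].
  by rewrite /subitv/= (le_trans ap pq) q12 (le_trans qp pb).
rewrite !pairwise_cat allrel_catl s2s1 ps2 prs1 (cuts_apart pt) /= !andbT.
apply/andP; split.
  apply/allrelP => q r qc rs; rewrite apartC; apply: (@apart_sub p).
    by move/allP: tp => /(_ _ qc); case: (p).
  by rewrite apartC; move/allP: ps1 => /(_ _ rs).
apply/allrelP => r q rs qc; apply: (@apart_sub p).
  by move/allP: tp => /(_ _ qc); case: (p).
by move/allP: s2p => /(_ _ rs).
Qed.

(* The intervals of s1 are replaced one at a time by the cells of a partition,
   so that no simultaneous choice of partitions is needed. *)
Lemma packing_total_variation a b f (e d : R) :
  (forall s, packing a b s -> \sum_(p <- s) (p.2 - p.1) < d ->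
    \sum_(p <- s) `|f p.2 - f p.1| <= e) ->
  forall s1 s2, packing a b (s2 ++ s1) ->
    \sum_(p <- s2 ++ s1) (p.2 - p.1) < d ->
  (\sum_(p <- s1) total_variation p.1 p.2 f +
    (\sum_(p <- s2) `|f p.2 - f p.1|)%:E <= e%:E)%E.
Proof.
move=> He; elim=> [|p s1 ih] s2 ps2 ls2.
  by rewrite big_nil add0e lee_fin; rewrite cats0 in ps2 ls2; exact: He.
have p12 : p.1 <= p.2.
  by move: ps2 => /andP[]; rewrite all_cat/= => /and3P[_ /and3P[]].
set C := (\sum_(q <- s1) total_variation q.1 q.2 f +
    (\sum_(q <- s2) `|f q.2 - f q.1|)%:E)%E.
have C0 : (0 <= C)%E.
  rewrite adde_ge0//; last by rewrite lee_fin sumr_ge0.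
  rewrite big_seq; apply: sume_ge0 => q qs1; apply: total_variation_ge0.
  by move: ps2 => /andP[/allP/(_ q)]; rewrite mem_cat inE qs1 !orbT => /(_ isT)/and3P[].
have H t : itv_partition p.1 p.2 t -> ((variation p.1 p.2 f t)%:E + C <= e%:E)%E.
  move=> pt; have := ih (s2 ++ cuts p.1 t) (packing_refine ps2 pt).
  rewrite !big_cat/= (length_cuts pt) -(variation_cuts f pt) EFinD.
  move=> H; rewrite addeC /C -addeA; apply: H.
  by move: ls2; rewrite big_cat/= big_cons; lra.
have [t pt] : exists t, itv_partition p.1 p.2 t.
  move: p12; rewrite le_eqVlt => /predU1P[->|/itv_partition1 pt]; last by exists [:: p.2].
  by exists [::]; split => /=.
have Cfin : C \is a fin_num.
  rewrite ge0_fin_numE//; apply: (@le_lt_trans _ _ e%:E); last exact: ltry.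
  by apply: le_trans (H _ pt); rewrite leeDr// lee_fin variation_ge0.
rewrite big_cons -addeA -/C -leeBrDr//.
by apply: ge_ereal_sup => _ [_ [u pu <-] <-]; rewrite leeBrDr//; exact: H.
Qed.

Lemma packing1 a b x y : a <= x -> x <= y -> y <= b -> packing a b [:: (x, y)].
Proof. by move=> ax xy yb; rewrite /packing/= /subitv/= ax xy yb. Qed.

(** Intervals shorter than the [d] attached to [e = 1] have variation at most 1, and finitely many
    steps of length [d / 2] lead from [a] to [b]. *)
Lemma abs_cont_bounded_variation a b f : a <= b ->
  seq_abs_cont a b f -> bounded_variation a b f.
Proof.
move=> ab fac; apply/bounded_variationP => //.
have [d d0 fd] := fac 1 ltr01.
have small x y : a <= x -> x <= y -> y <= b -> y - x < d ->
    (total_variation x y f <= 1%:E)%E.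
  move=> ax xy yb yxd; have := packing_total_variation fd (s1 := [:: (x, y)]) (s2 := [::]).
  rewrite /= big_seq1 big_nil adde0 big_seq1/=; apply => //.
  exact: packing1.
suff H n x : a <= x -> x <= b -> x - a < n%:R * (d / 2) -> (total_variation a x f < +oo)%E.
  rewrite ge0_fin_numE ?total_variation_ge0//.
  have d2 : 0 < d / 2 by rewrite divr_gt0.
  apply: (H (Num.bound ((b - a) / (d / 2)))) => //.
  by rewrite -ltr_pdivrMr// archi_boundP// divr_ge0 ?subr_ge0// ltW.
elim: n x => [|n ih] x ax xb; first by rewrite mul0r => ?; exfalso; lra.
rewrite mulrS mulrDl mul1r => xn; have [xd|xd] := leP a (x - d / 2).
  rewrite (@total_variationD _ a x (x - d / 2)) //; last by lra.
  rewrite lte_add_pinfty//; first by apply: ih => //; lra.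
  by rewrite (@le_lt_trans _ _ 1%:E) ?ltry//; apply: small => //; lra.
by rewrite (@le_lt_trans _ _ 1%:E) ?ltry//; apply: small => //; lra.
Qed.

(** The increments of the variation function are the total variations over the intervals, so
    [packing_total_variation] with [s2] empty gives the claim with the same [d]. *)
Lemma abs_cont_total_variation a b f : a <= b -> seq_abs_cont a b f ->
  seq_abs_cont a b (fun x => fine (total_variation a x f)).
Proof.
move=> ab fac e e0; have [d d0 fd] := fac e e0; exists d => // s ps ls.
have := packing_total_variation fd (s1 := s) (s2 := [::]) ps ls.
rewrite big_nil adde0 -lee_fin; apply: le_trans.
have bv := abs_cont_bounded_variation ab fac.
have fin x : a <= x -> x <= b -> total_variation a x f \is a fin_num.
  by move=> ax xb; apply/bounded_variationP => //; exact: bounded_variationl bv.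
rewrite -sumEFin big_seq [leRHS]big_seq; apply: lee_sum => p.
move: ps => /andP[/allP ps _] /ps /and3P[/= ap p12 pb].
rewrite (total_variationD f ap p12) fineD; last 2 first.
- by apply: fin => //; exact: le_trans p12 pb.
- apply/bounded_variationP => //; apply: bounded_variationr (bounded_variationl _ pb bv) => //.
  exact: le_trans ap p12.
rewrite addrAC subrr add0r ger0_norm ?fine_ge0 ?total_variation_ge0// fineK//.
apply/bounded_variationP => //; apply: bounded_variationr (bounded_variationl _ pb bv) => //.
exact: le_trans ap p12.
Qed.

Lemma seq_abs_contB a b f h : seq_abs_cont a b f -> seq_abs_cont a b h ->
  seq_abs_cont a b (f \- h).
Proof.
move=> fac hac e e0; have e20 : 0 < e / 2 by rewrite divr_gt0.
have [d1 d10 fd] := fac _ e20; have [d2 d20 hd] := hac _ e20.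
exists (Num.min d1 d2); first by rewrite lt_min d10.
move=> s ps; rewrite lt_min => /andP[s1 s2].
apply: le_trans (_ : \sum_(p <- s) (`|f p.2 - f p.1| + `|h p.2 - h p.1|) <= _).
  apply: ler_sum => p _ /=.
  by rewrite (_ : _ - _ - _ = (f p.2 - f p.1) - (h p.2 - h p.1)) ?ler_normB//; ring.
by rewrite big_split/= (splitr e) lerD ?fd ?hd.
Qed.

End AbsolutelyContinuous.

(** * Lebesgue-Stieltjes measures of absolutely continuous functions *)

Section StieltjesAbsolutelyContinuous.
Context {R : realType}.
Implicit Types (a b x y : R) (f h : R -> R) (p q : R * R) (s : seq (R * R)).
Local Notation mu := (@lebesgue_measure R).

Lemma lebesgue_stieltjes_itvoc (H : cumulative R R) x y : x <= y ->
  lebesgue_stieltjes_measure H `]x, y]%classic = (H y - H x)%:E.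
Proof.
move=> xy; rewrite /lebesgue_stieltjes_measure/= /measure_extension/=.
rewrite measurable_mu_extE/=; last exact: is_ocitv.
by rewrite wlength_itv_bnd.
Qed.

(** The sequence [s] is chosen before [H], because the same intervals must compute both the Lebesgue
    length and the Stieltjes mass of the union. *)
Lemma lebesgue_stieltjes_bigsetU (A : nat -> set (ocitv_type R)) n :
  (forall i, measurable (A i)) ->
  exists s, [/\ all (fun p => p.1 <= p.2) s, pairwise apart s &
    forall H : cumulative R R,
      lebesgue_stieltjes_measure H (\big[setU/set0]_(i < n) A i) =
      (\sum_(p <- s) (H p.2 - H p.1))%:E].
Proof.
move=> mA.
have mU : measurable (\big[setU/set0]_(i < n) A i : set (SetRing.type (ocitv_type R))).
  by apply: bigsetU_measurable => i _; apply: sub_gen_smallest; exact: mA.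
have [B [finB B0 tB mB UB]] := SetRing.ring_finite_set mU.
have Bitv X : B X -> exists2 p, p.1 < p.2 & X = `]p.1, p.2]%classic.
  move=> BX; have /ocitvP[X0|//] : ocitv X by apply: mB; rewrite inE.
  by have [z] := B0 _ BX; rewrite X0.
have memB X : X \in fset_set B -> B X by rewrite in_fset_set// inE.
pose io (X : set R) := (inf X, sup X).
have ioE p : p.1 < p.2 -> io `]p.1, p.2]%classic = p.
  by move=> p12; rewrite /io inf_itv ?sup_itv ?bnd_simp//; case: (p).
exists [seq io X | X <- fset_set B]; split.
- apply/allP => _ /mapP[X /memB/Bitv[p p12 ->] ->].
  by rewrite ioE// ltW.
- rewrite pairwise_map; have := fset_uniq (fset_set B); rewrite uniq_pairwise.
  apply: (@sub_in_pairwise _ [pred X | X \in fset_set B]); last exact/allP.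
  move=> X Y XB YB XY; have BX : B X by exact: memB XB.
  have BY : B Y by exact: memB YB.
  have [p p12 Xp] := Bitv _ BX; have [q q12 Yq] := Bitv _ BY.
  rewrite /= Xp Yq !ioE// /apart leNgt [X in _ || X]leNgt -negb_and.
  apply/negP => /andP[qp pq]; move/eqP: XY; apply; apply: tB => //=.
  (* Two overlapping half-open intervals share the smaller right end, so disjointness of the pieces
     would force [X = Y]. *)
  exists (Num.min p.2 q.2); split; rewrite ?Xp ?Yq /= in_itv/=.
    by rewrite lt_min p12 pq/= ge_min lexx.
  by rewrite lt_min q12 qp/= ge_min lexx orbT.
move=> H; rewrite UB.
have mBH X : B X -> measurable (X : set (measurableTypeR R)).
  by move=> /Bitv[p _ ->]; exact: measurable_itv.
rewrite (measure_fin_bigcup (lebesgue_stieltjes_measure H))//=.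
rewrite fsbig_finite//= big_map -sumEFin big_seq [RHS]big_seq.
apply: eq_bigr => X /memB/Bitv[p p12 ->].
by rewrite ioE// lebesgue_stieltjes_itvoc// ltW.
Qed.

(** Composition with this projection onto [[a, b]] freezes a function outside the interval, which
    turns a monotone [h] into a cumulative function on the whole line. Being monotone and
    1-Lipschitz, it sends non-overlapping intervals to a packing of no larger total length. *)
Definition clamp a b x := Num.max a (Num.min x b).

Lemma clamp_ge a b x : a <= clamp a b x.
Proof. by rewrite /clamp le_max lexx. Qed.

Lemma clamp_le a b x : a <= b -> clamp a b x <= b.
Proof. by move=> ab; rewrite /clamp ge_max ab ge_min lexx orbT. Qed.

Lemma le_clamp a b x y : x <= y -> clamp a b x <= clamp a b y.
Proof. by rewrite /clamp => xy; apply: le_max2 => //; apply: le_min2. Qed.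

Lemma clamp_lip a b x y : x <= y -> clamp a b y - clamp a b x <= y - x.
Proof.
rewrite /clamp => xy; rewrite /Num.max /Num.min.
by have [?|?] := ltP y b; have [?|?] := ltP x b;
  do !(case: ifPn; rewrite -?leNgt => ?); lra.
Qed.

Lemma clamp_id a b x : a <= x -> x <= b -> clamp a b x = x.
Proof. by move=> ax xb; rewrite /clamp (min_idPl xb) (max_idPr ax). Qed.

Lemma packing_clamp a b s : a <= b ->
  all (fun p => p.1 <= p.2) s -> pairwise apart s ->
  packing a b [seq (clamp a b p.1, clamp a b p.2) | p <- s].
Proof.
move=> ab /allP s12 aps; apply/andP; split.
  apply/allP => _ /mapP[p ps ->]; apply/and3P; split=> /=.
  - exact: clamp_ge.
  - exact/le_clamp/s12.
  - exact: clamp_le.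
rewrite pairwise_map; apply: sub_pairwise aps => p q /orP[h|h].
  by apply/orP; left; exact: le_clamp.
by apply/orP; right; exact: le_clamp.
Qed.

Lemma seq_abs_cont_clamp a b h : a <= b -> seq_abs_cont a b h ->
  continuous (h \o clamp a b).
Proof.
move=> ab hac x; apply/cvgrPdist_le => e e0.
have [d d0 hd] := hac _ e0; near=> y.
have xyd : `|x - y| < d by near: y; exact: cvgr_dist_lt d0.
have main u v : u <= v -> v - u < d -> `|h (clamp a b v) - h (clamp a b u)| <= e.
  move=> uv uvd; have := hd [:: (clamp a b u, clamp a b v)].
  rewrite !big_seq1/=; apply.
    by apply: packing1; rewrite ?clamp_ge ?clamp_le ?le_clamp.
  exact: le_lt_trans (clamp_lip _ _ _) _.
have [xy|/ltW yx] := leP x y.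
  by rewrite distrC main// -(ger0_norm (_ : 0 <= y - x)) ?subr_ge0// distrC.
by rewrite main// -(ger0_norm (_ : 0 <= x - y)) ?subr_ge0.
Unshelve. all: by end_near. Qed.

(** Absolute continuity controls finitely many intervals at a time. A null set is covered by
    half-open intervals of total length below [d]; each finite partial union has mass at most [e],
    and continuity from below extends this to the whole cover. *)
Lemma lebesgue_stieltjes_dominated a b h (H : cumulative R R) : a <= b ->
  seq_abs_cont a b h -> H =1 h \o clamp a b ->
  lebesgue_stieltjes_measure H `<< mu.
Proof.
move=> ab hac HE; apply/null_content_dominatesP => N mN N0.
apply/eqP; rewrite eq_le measure_ge0 andbT; apply/lee_addgt0Pr => e e0; rewrite add0e.
have [d d0 hd] := hac _ e0.
have /ereal_inf_lt[z [/= M covM sMz zd]] : (mu N < d%:E)%E by rewrite N0 lte_fin.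
have [mM NM] := covM.
have mM' i : measurable (M i : set (measurableTypeR R)) by exact: sub_sigma_algebra.
pose F n := \big[setU/set0]_(i < n) M i : set (measurableTypeR R).
have mF n : measurable (F n) by apply: bigsetU_measurable.
have mUM : measurable (\bigcup_n F n) by exact: bigcup_measurable.
have lamF n : (mu (F n) < d%:E)%E.
  apply: le_lt_trans zd; rewrite -sMz.
  apply: (@le_trans _ _ (\sum_(i < n) mu (M i))%E).
    exact: content_subadditive.
  rewrite (_ : (\sum_(i < n) mu (M i) = \sum_(0 <= i < n) wlength idfun (M i))%E).
    by apply: nneseries_lim_ge.
  rewrite big_mkord; apply: eq_bigr => i _.
  by rewrite /lebesgue_measure/= /lebesgue_stieltjes_measure/= /measure_extension/= measurable_mu_extE.
have nuF n : (lebesgue_stieltjes_measure H (F n) <= e%:E)%E.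
  have [s [s12 aps sE]] := lebesgue_stieltjes_bigsetU n mM.
  rewrite sE lee_fin; have := lamF n; rewrite /lebesgue_measure [X in (X < _)%E]sE lte_fin => sd.
  have := hd _ (packing_clamp ab s12 aps); rewrite !big_map/= => {}hd.
  apply: le_trans (hd _).
    by apply: ler_sum => p _; rewrite !HE/= ler_norm.
  apply: le_lt_trans sd; rewrite big_seq [leRHS]big_seq; apply: ler_sum => p ps.
  by apply: clamp_lip; move/allP: s12 => /(_ _ ps).
apply: (@le_trans _ _ (lebesgue_stieltjes_measure H (\bigcup_n F n))).
  apply: le_measure; rewrite ?inE//.
  by move=> x /NM[k _ Mkx]; exists k.+1 => //; rewrite /F -bigcup_mkord; exists k => /=.
have Fcvg : lebesgue_stieltjes_measure H \o F @ \oo -->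
    lebesgue_stieltjes_measure H (\bigcup_n F n).
  apply: nondecreasing_cvg_mu => // m n mn; apply/subsetPset.
  exact: subset_bigsetU.
rewrite -(cvg_lim _ Fcvg)//; apply: lime_le; first by apply/cvg_ex; eexists; exact: Fcvg.
exact: nearW.
Qed.

Lemma nondecreasing_abs_cont_integral a b h : a < b ->
  {in `[a, b] &, nondecreasing_fun h} -> seq_abs_cont a b h ->
  exists g : R -> R, [/\ mu.-integrable setT (EFin \o g) &
    forall x, a <= x -> x <= b ->
      h x - h a = \int[mu]_(t in `]a, x]) g t].
Proof.
move=> ab ndh hac; have lab := ltW ab.
have ndH : nondecreasing (h \o clamp a b).
  move=> x y xy /=; apply: ndh; rewrite ?in_itv/= ?clamp_ge ?clamp_le//.
  exact: le_clamp.
have rcH := right_continuousW (seq_abs_cont_clamp lab hac).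
pose H : cumulative R R := HB.pack (h \o clamp a b)
  (isCumulative.Build R _ R (h \o clamp a b) ndH rcH).
have domH : lebesgue_stieltjes_measure H `<< mu.
  exact: (@lebesgue_stieltjes_dominated a b h).
have mab : measurable (`]a, b]%classic : set (measurableTypeR R)) by [].
have ooab : (lebesgue_stieltjes_measure H `]a, b]%classic < +oo)%E.
  by rewrite lebesgue_stieltjes_itvoc// ltry.
(* On []a, b]] the measure is visibly finite, which makes its density integrable. *)
pose nu := mfrestr mab ooab.
have domnu : nu `<< mu.
  apply/null_content_dominatesP => A mA A0.
  rewrite /nu/= /mfrestr/= /mrestr.
  move/null_content_dominatesP : domH; apply; first exact: measurableI.
  by apply/eqP; rewrite eq_le measure_ge0 andbT -A0 le_measure ?inE//; exact: measurableI.
have [g [g0 gfin gint gE]] := radon_nikodym_sigma_finite domnu.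
have ig : mu.-integrable setT (EFin \o (fine \o g)).
  by apply: eq_integrable gint => // x _ /=; rewrite fineK.
exists (fine \o g); split => //.
move=> x ax xb; apply/EFin_inj.
have <- : (\int[mu]_(t in `]a, x]) g t)%E = (h x - h a)%:E.
  rewrite -gE// [LHS]/= /mfrestr/= /mrestr setIidl; last by apply: subset_itvl; rewrite bnd_simp.
  by rewrite lebesgue_stieltjes_itvoc//= !clamp_id.
rewrite /Rintegral fineK; first by apply: eq_integral => t _ /=; rewrite fineK.
by apply: integrable_fin_num => //; exact: integrableS ig.
Qed.

Lemma seq_abs_cont_integral a b f : a < b -> seq_abs_cont a b f ->
  exists g : R -> R, [/\ mu.-integrable setT (EFin \o g) &
    forall x, a <= x -> x <= b ->
      f x - f a = \int[mu]_(t in `]a, x]) g t].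
Proof.
move=> ab fac; have lab := ltW ab; have bv := abs_cont_bounded_variation lab fac.
pose v x := fine (total_variation a x f).
have vac : seq_abs_cont a b v := abs_cont_total_variation lab fac.
have fin x : a <= x -> x <= b -> total_variation a x f \is a fin_num.
  by move=> ax xb; apply/bounded_variationP => //; exact: bounded_variationl bv.
have vB x y : a <= x -> x <= y -> y <= b -> `|f y - f x| <= v y - v x.
  move=> ax xy yb; rewrite -lee_fin EFinB /v !fineK ?fin//; last 2 first.
  - exact: le_trans xy yb.
  - exact: le_trans ax xy.
  rewrite (total_variationD f ax xy) addeAC subee ?add0e ?fin//; last exact: le_trans xy yb.
  exact: total_variation_ge.
have [|g1 [ig1 g1E]] := @nondecreasing_abs_cont_integral a b v ab _ vac.
  move=> x y; rewrite !in_itv/= => /andP[ax xb] /andP[ay yb] xy.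
  by rewrite -subr_ge0; apply: le_trans (vB _ _ ax xy yb).
have [|g2 [ig2 g2E]] := @nondecreasing_abs_cont_integral a b (v \- f) ab _ (seq_abs_contB vac fac).
  move=> x y; rewrite !in_itv/= => /andP[ax xb] /andP[ay yb] xy.
  by have := vB _ _ ax xy yb; rewrite ler_norml => /andP[_]; lra.
exists (g1 \- g2); split.
  rewrite (_ : _ \o _ = (EFin \o g1) \- (EFin \o g2))%E; first exact: integrableB.
  by apply/funext => t.
move=> x ax xb; rewrite RintegralB//; last 2 first.
- exact: integrableS ig1.
- exact: integrableS ig2.
by rewrite -g1E// -g2E//=; ring.
Qed.

End StieltjesAbsolutelyContinuous.

(** * Fundamental theorem of calculus for absolutely continuous functions *)

Section FundamentalTheorem.
Context {R : realType}.
Implicit Types (a b x y : R) (f h : R -> R).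
Local Notation mu := (@lebesgue_measure R).

(** Differentiability almost everywhere is Lebesgue's theorem for the indefinite integral of [g],
    with which [f] agrees up to a constant near each point of []a, b[]. *)
Lemma seq_abs_cont_FTC a b f : a < b -> seq_abs_cont a b f ->
  exists g : R -> R, [/\ mu.-integrable setT (EFin \o g),
    forall x y, a <= x -> x <= y -> y <= b ->
      f y - f x = \int[mu]_(t in `]x, y]) g t &
    {ae mu, forall x, a < x < b -> is_derive x 1 f (g x)}].
Proof.
move=> ab /(seq_abs_cont_integral ab)[g [ig gE]]; exists g; split => //.
  move=> x y ax xy yb; rewrite (_ : _ - _ = (f y - f a) - (f x - f a)); last by ring.
  rewrite (gE _ (le_trans ax xy) yb) (gE _ ax (le_trans xy yb)).
  rewrite (@Rintegral_itvB _ _ (BRight a) (BRight y) x)//; last first.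
  - exact: integrableS ig.
have locg : locally_integrable [set: R] g by exact: open_integrable_locally openT ig.
have igy y : mu.-integrable [set` Interval (BRight a) (BRight y)] (EFin \o g).
  exact: integrableS ig.
have := FTC1 igy locg.
apply: filterS; first exact: (ae_filter_ringOfSetsType mu).
move=> x /= H /andP[ax xb].
have [|dF F1] := H; first by rewrite lte_fin.
pose F x := \int[mu]_(t in `]a, x]) g t.
have Fx : is_derive x 1 F (g x) by apply: DeriveDef => //; rewrite -derive1E.
have FfE : {near x, (F \+ cst (f a)) =1 f}.
  near=> y; rewrite /F/= -gE ?subrK//; apply/ltW; near: y.
    by apply: (cvgr_gt x) => //; exact: cvg_id.
  by apply: (cvgr_lt x) => //; exact: cvg_id.
have := is_deriveD Fx (is_derive_cst (f a) x 1); rewrite addr0.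
by apply: near_eq_is_derive; rewrite ?oner_eq0.
Unshelve. all: by end_near. Qed.

End FundamentalTheorem.

(** * A Gaussian bound on the square of the error function *)

Section GaussianBound.
Context {R : realType}.
Implicit Types (t u x c : R).

Lemma is_derive_ext (f g : R -> R) (x df dg : R) : is_derive x 1 f df ->
  f =1 g -> df = dg -> is_derive x 1 g dg.
Proof. by move=> fx /funext <- <-. Qed.

Lemma is_derive_expR_sqr (k t : R) :
  is_derive t 1 (fun u => expR (- u ^+ 2 / k)) (- (2 * t / k) * expR (- t ^+ 2 / k)).
Proof.
have d2 := is_deriveM (is_derive_id t 1) (is_derive_id t 1).
have d1 := is_deriveM (is_deriveN d2) (is_derive_cst k^-1 t 1).
apply: (is_derive_ext (is_derive1_comp (is_derive_expR _) d1)) => [u|].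
  by rewrite /= !fctE/= expr2.
by rewrite /GRing.scale/= !fctE/= expr2; ring.
Qed.

Lemma expR_sqr_small (k : R) : 0 < k ->
  expR (- u ^+ 2 / k) @[u --> +oo] --> (0 : R).
Proof.
move=> k0; apply: (@squeeze_cvgr _ _ _ _ (cst 0) (fun u => k * u^-1)).
- near=> u; rewrite expR_ge0/=.
  have u1 : 1 <= u by near: u; exact: nbhs_pinfty_ge.
  have u0 : 0 < u by apply: lt_le_trans u1.
  rewrite mulNr expRN -[leRHS]invrK invfM invrK lef_pV2 ?posrE ?expR_gt0//; last first.
    by rewrite mulr_gt0 ?invr_gt0.
  rewrite (le_trans _ (expR_ge1Dx _))// (le_trans _ (_ : u ^+ 2 / k <= _))//; last by rewrite lerDr.
  by rewrite mulrC ler_pM2r ?invr_gt0// expr2 ler_peMr// ltW.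
- exact: cvg_cst.
- rewrite -[X in _ --> X](mulr0 k); apply: cvgM; first exact: cvg_cst.
  apply/gtr0_cvgV0; first by near=> x; near: x; exact: nbhs_pinfty_gt.
  exact: cvg_id.
Unshelve. all: by end_near. Qed.

(* D and k below vanish at 0 and k' changes sign once, so a negative value of
   D would keep D bounded away from its limit 0 at infinity. *)
Lemma sqr_erf_le (s P : R) (G : R -> R) : 0 < s -> 0 <= P -> G 0 = 0 ->
  (forall u, is_derive u 1 G (2 * P * expR (- u ^+ 2 / (2 * s ^+ 2)))) ->
  G u @[u --> +oo] --> (1 : R) ->
  forall u, 0 <= u -> G u ^+ 2 <= 1 - expR (- u ^+ 2 / s ^+ 2).
Proof.
move=> s0 P0 G0 dG Gy u0 u0ge0.
have s20 : 0 < s ^+ 2 by rewrite exprn_gt0.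
pose E (u : R) : R := expR (- u ^+ 2 / (2 * s ^+ 2)).
(* [D] is the slack of the claim, with derivative [2 * E u * k u]. The last factor of [k'] decreases
   for [u >= 0], whence its single change of sign. *)
pose D (u : R) : R := 1 - expR (- u ^+ 2 / s ^+ 2) - G u ^+ 2.
pose k (u : R) : R := u / s ^+ 2 * E u - 2 * P * G u.
pose k' (u : R) : R := E u / s ^+ 2 * (1 - 4 * P ^+ 2 * s ^+ 2 - u ^+ 2 / s ^+ 2).
have EE u : expR (- u ^+ 2 / s ^+ 2) = E u * E u.
  by rewrite /E -expRD; congr expR; field; rewrite gt_eqF.
have dD u : is_derive u 1 D (2 * E u * k u).
  have d1 := is_derive_expR_sqr (s ^+ 2) u.
  have d2 := is_deriveM (dG u) (dG u).
  apply: (is_derive_ext (is_deriveB (is_deriveB (is_derive_cst (1 : R) u 1) d1) d2)).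
    by move=> x; rewrite /D !fctE expr2.
  rewrite EE /k -/(E u) /GRing.scale/=.
  by field; rewrite gt_eqF.
have dk u : is_derive u 1 k (k' u).
  have d1 := is_deriveM (is_deriveM (is_derive_id u 1) (is_derive_cst (s ^+ 2)^-1 u 1))
    (is_derive_expR_sqr (2 * s ^+ 2) u).
  have d2 := is_deriveM (is_derive_cst (2 * P) u 1) (dG u).
  apply: (is_derive_ext (is_deriveB d1 d2)) => [//|].
  rewrite /k' -/(E u) /GRing.scale/= !fctE/=.
  by field; rewrite gt_eqF.
have cont (h : R -> R) (h' : R -> R) x y : (forall u, is_derive u 1 h (h' u)) ->
    {within `[x, y], continuous h}.
  move=> dh; apply: continuous_subspaceT => z.
  by apply: differentiable_continuous; apply/derivable1_diffP; case: (dh z).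
have E0 u : 0 < E u := expR_gt0 _.
have D0 : D 0 = 0 by rewrite /D G0 expr0n/= oppr0 mul0r expR0; ring.
have k0 : k 0 = 0 by rewrite /k G0; ring.
rewrite -subr_ge0 -/(D u0) leNgt; apply/negP => Du0.
have {}u0ge0 : 0 < u0.
  by rewrite lt_neqAle u0ge0 andbT; apply/eqP => u00; rewrite -u00 D0 ltxx in Du0.
have [x1] := MVT u0ge0 (fun x _ => dD x) (cont _ _ 0 u0 dD).
rewrite in_itv/= D0 !subr0 => /andP[x10 x1u0] Dx1.
have kx1 : k x1 < 0.
  move: Du0; rewrite Dx1 pmulr_llt0// pmulr_rlt0//.
  by rewrite mulr_gt0.
have [x2] := MVT x10 (fun x _ => dk x) (cont _ _ 0 x1 dk).
rewrite in_itv/= k0 !subr0 => /andP[x20 x21] kx2.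
have k'x2 : 1 - 4 * P ^+ 2 * s ^+ 2 - x2 ^+ 2 / s ^+ 2 < 0.
  by move: kx1; rewrite kx2 pmulr_llt0// /k' pmulr_rlt0// divr_gt0.
have k'neg x : x2 <= x -> k' x <= 0.
  move=> x2x; rewrite /k' pmulr_rle0 ?divr_gt0//; apply/ltW/(le_lt_trans _ k'x2).
  rewrite lerD2l lerN2 ler_pM2r ?invr_gt0// ler_sqr ?nnegrE//; first exact: ltW.
  by apply: le_trans x2x; exact: ltW.
have kneg x : x1 <= x -> k x <= 0.
  rewrite le_eqVlt => /predU1P[<-|x1x]; first exact: ltW.
  have [y] := MVT x1x (fun x _ => dk x) (cont _ _ x1 x dk).
  rewrite in_itv/= => /andP[x1y yx] kxE.
  have : k' y * (x - x1) <= 0.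
    apply: mulr_le0_ge0; last by rewrite subr_ge0 ltW.
    by apply: k'neg; apply: ltW; exact: lt_trans x1y.
  by rewrite -kxE; lra.
have Dneg x : u0 <= x -> D x <= D u0.
  rewrite le_eqVlt => /predU1P[<-//|u0x].
  have [y] := MVT u0x (fun x _ => dD x) (cont _ _ u0 x dD).
  rewrite in_itv/= => /andP[u0y yx] DxE.
  have : 2 * E y * k y * (x - u0) <= 0.
    apply: mulr_le0_ge0; last by rewrite subr_ge0 ltW.
    rewrite pmulr_rle0; last by rewrite mulr_gt0.
    by apply: kneg; apply: ltW; exact: lt_trans u0y.
  by rewrite -DxE; lra.
have Dy : D u @[u --> +oo] --> (0 : R).
  rewrite [X in _ --> X](_ : 0 = 1 - 0 - 1 * 1); last by ring.
  apply: cvgB; first by apply: cvgB; [exact: cvg_cst|exact: expR_sqr_small].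
  exact: cvgM.
have : lim (D u @[u --> +oo]) <= D u0.
  apply: limr_le; first by apply/cvg_ex; exists 0.
  by near=> u; apply: Dneg; near: u; apply: nbhs_pinfty_ge; rewrite num_real.
by rewrite (cvg_lim _ Dy)// leNgt Du0.
Unshelve. all: by end_near. Qed.

End GaussianBound.

(** * The normal location family and its derivative in the mean *)

Section NormalFamily.
Context {R : realType} (s : R).
Hypothesis s_gt0 : 0 < s.
Implicit Types (t u x c : R) (A : set (measurableTypeR R)).
Local Notation mu := (@lebesgue_measure R).
Local Notation pdf t := (normal_pdf t s).

Let s_neq0 : s != 0. Proof. by rewrite gt_eqF. Qed.
Let s2_gt0 : 0 < s ^+ 2. Proof. by rewrite exprn_gt0. Qed.

Lemma normal_pdf_expR t x :
  pdf t x = normal_peak s * expR (- (x - t) ^+ 2 / (2 * s ^+ 2)).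
Proof. by rewrite normal_pdfE// /normal_fun mulr_natl. Qed.

Lemma sqr_normal_peak : normal_peak s ^+ 2 = (2 * pi * s ^+ 2)^-1 :> R.
Proof.
rewrite /normal_peak exprVn sqr_sqrtr; last first.
  by rewrite mulrn_wge0// mulr_ge0 ?pi_ge0// ltW.
by congr (_ ^-1); rewrite -mulr_natl; ring.
Qed.

Definition dnormal_pdf t x := (x - t) / s ^+ 2 * pdf t x.

Lemma is_derive_normal_pdf_mean t x :
  is_derive t 1 (fun u => pdf u x) (dnormal_pdf t x).
Proof.
have d1 : is_derive t 1 (fun u : R => x - u) (- 1 : R).
  apply: (is_derive_ext (is_deriveB (is_derive_cst x t 1) (is_derive_id t 1))) => //.
  by rewrite sub0r.
have d2 := @is_derive1_comp _ (fun z => expR (- z ^+ 2 / (2 * s ^+ 2))) (fun u => x - u) t _ _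
  (is_derive_expR_sqr (2 * s ^+ 2) (x - t)) d1.
apply: (is_derive_ext (is_deriveM (is_derive_cst (normal_peak s) t 1) d2)) => [u|].
  by rewrite normal_pdf_expR.
by rewrite /dnormal_pdf normal_pdf_expR /GRing.scale/=; field.
Qed.

Lemma is_derive_normal_pdf t x :
  is_derive x 1 (pdf t) (- dnormal_pdf t x).
Proof.
have d1 : is_derive x 1 (fun u : R => u - t) (1 : R).
  apply: (is_derive_ext (is_deriveB (is_derive_id x 1) (is_derive_cst t x 1))) => //.
  by rewrite subr0.
have d2 := @is_derive1_comp _ (fun z => expR (- z ^+ 2 / (2 * s ^+ 2))) (fun u => u - t) x _ _
  (is_derive_expR_sqr (2 * s ^+ 2) (x - t)) d1.
apply: (is_derive_ext (is_deriveM (is_derive_cst (normal_peak s) x 1) d2)) => [u|].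
  by rewrite normal_pdf_expR.
by rewrite /dnormal_pdf normal_pdf_expR /GRing.scale/=; field.
Qed.

Lemma continuous_dnormal_pdf t : continuous (dnormal_pdf t).
Proof.
move=> x; apply: cvgM; last exact: continuous_normal_pdf.
apply: cvgM; last exact: cvg_cst.
by apply: cvgB; [exact: cvg_id|exact: cvg_cst].
Qed.

Lemma measurable_dnormal_pdf t : measurable_fun setT (dnormal_pdf t).
Proof. by apply: continuous_measurable_fun; exact: continuous_dnormal_pdf. Qed.

(* With z = x - u and w = x - t one has w^2 <= 2 z^2 + 2, and
   |z| <= s exp(z^2 / (4 s^2)); the remaining Gaussian has deviation 2 s. *)
Lemma dnormal_pdf_dominated : exists2 C, 0 <= C & forall t u x, `|u - t| < 1 ->
  `|dnormal_pdf u x| <= C * normal_pdf t (2 * s) x.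
Proof.
pose P := normal_peak s; pose P2 := normal_peak (2 * s).
have P0 : 0 < P := normal_peak_gt0 s_neq0.
have s20 : 2 * s != 0 by rewrite mulf_neq0// pnatr_eq0.
have P20 : 0 < P2 := normal_peak_gt0 s20.
pose K : R := expR (1 / (4 * s ^+ 2)).
exists (s^-1 * P / P2 * K).
  by rewrite !mulr_ge0 ?invr_ge0 ?expR_ge0// ltW.
move=> t u x ut1; rewrite /dnormal_pdf normal_pdf_expR normal_pdfE// -/P.
rewrite /normal_fun -/P2 [leRHS](_ : _ = s^-1 * P * (K * expR (- (x - t) ^+ 2 / ((2 * s) ^+ 2 *+ 2)))); last first.
  by field; rewrite s_neq0 gt_eqF.
rewrite !normrM (gtr0_norm P0) (gtr0_norm (expR_gt0 _)) normfV (gtr0_norm s2_gt0).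
set z := x - u; set w := x - t.
have wz : w ^+ 2 <= 2 * z ^+ 2 + 2.
  have -> : w = z + (u - t) by rewrite /w /z; ring.
  have : (u - t) ^+ 2 <= 1.
    by rewrite -real_normK ?num_real// expr_le1// ltW.
  by have := sqr_ge0 (z - (u - t)); nra.
have E1 : expR (- z ^+ 2 / (4 * s ^+ 2)) <= K * expR (- w ^+ 2 / ((2 * s) ^+ 2 *+ 2)).
  rewrite /K -expRD ler_expR -subr_ge0.
  rewrite (_ : _ - _ = (2 * z ^+ 2 + 2 - w ^+ 2) / (8 * s ^+ 2)); last first.
    by rewrite -mulr_natl exprMn; field.
  by rewrite divr_ge0 ?subr_ge0// mulr_ge0// ltW.
have E2 : `|z| <= s * expR (z ^+ 2 / (4 * s ^+ 2)).
  apply: (@le_trans _ _ (s * (1 + z ^+ 2 / (4 * s ^+ 2)))); last first.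
    by rewrite ler_pM2l// expR_ge1Dx.
  rewrite -subr_ge0 (_ : _ - _ = (`|z| - 2 * s) ^+ 2 / (4 * s)); last first.
    by rewrite -(real_normK (num_real z)); field.
  by rewrite divr_ge0 ?sqr_ge0// mulr_ge0// ltW.
have E3 : expR (- z ^+ 2 / (2 * s ^+ 2)) =
    expR (- z ^+ 2 / (4 * s ^+ 2)) * expR (- z ^+ 2 / (4 * s ^+ 2)).
  by rewrite -expRD; congr expR; field.
have E4 : `|z| * expR (- z ^+ 2 / (4 * s ^+ 2)) <= s.
  by rewrite mulNr expRN -ler_pdivlMr ?invr_gt0 ?expR_gt0// invrK.
rewrite E3 (_ : `|z| / s ^+ 2 * (P * _) = s^-1 ^+ 2 * P *
  ((`|z| * expR (- z ^+ 2 / (4 * s ^+ 2))) * expR (- z ^+ 2 / (4 * s ^+ 2)))); last first.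
  by rewrite exprVn; ring.
rewrite [leRHS](_ : _ = s^-1 ^+ 2 * P * (s * (K * expR (- w ^+ 2 / ((2 * s) ^+ 2 *+ 2))))); last by field.
rewrite ler_pM2l; last by rewrite mulr_gt0// exprn_gt0// invr_gt0.
by apply: ler_pM => //; rewrite ?mulr_ge0 ?expR_ge0.
Qed.

Lemma integrable_dnormal_pdf t A : measurable A ->
  mu.-integrable A (EFin \o dnormal_pdf t).
Proof.
move=> mA; have [C C0 dC] := dnormal_pdf_dominated.
apply: (@le_integrable _ _ _ mu A mA _ (fun x => C%:E * (normal_pdf t (2 * s) x)%:E)%E).
- by apply/measurable_EFinP; apply: measurable_funTS; exact: measurable_dnormal_pdf.
- move=> x _ /=; rewrite lee_fin [leRHS]ger0_norm ?mulr_ge0 ?normal_pdf_ge0//.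
  by apply: dC; rewrite subrr normr0.
- apply: integrableZl => //.
  by apply: integrableS (integrable_normal_pdf t (2 * s)).
Qed.

Lemma integrable_normal_pdfS t A : measurable A ->
  mu.-integrable A (EFin \o pdf t).
Proof. by move=> mA; apply: integrableS (integrable_normal_pdf t s). Qed.

Definition normal_mass A t : R := \int[mu]_(x in A) pdf t x.
Definition dnormal_mass A t : R := \int[mu]_(x in A) dnormal_pdf t x.

Lemma normal_massE A t : measurable A -> normal_prob t s A = (normal_mass A t)%:E.
Proof.
move=> mA; rewrite /normal_mass /Rintegral fineK//.
exact: integrable_fin_num (integrable_normal_pdfS _ _).
Qed.

(** Differentiation under the integral sign on the window []t - 1, t + 1[], where
    [dnormal_pdf_dominated] bounds all the derivatives by one integrable Gaussian. *)
Lemma is_derive_normal_mass A t : measurable A ->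
  is_derive t 1 (normal_mass A) (dnormal_mass A t).
Proof.
move=> mA; have [C C0 dC] := dnormal_pdf_dominated.
have It : `](t - 1), (t + 1)[%classic t by rewrite /= in_itv/=; apply/andP; split; lra.
have d1E u x : partial1of2 (fun v => pdf v) u x = dnormal_pdf u x.
  by rewrite partial1of2E; case: (is_derive_normal_pdf_mean u x).
have intf u : `](t - 1), (t + 1)[%classic u -> mu.-integrable A (EFin \o pdf u).
  by move=> _; exact: integrable_normal_pdfS.
have derf u x : `](t - 1), (t + 1)[%classic u -> A x -> derivable (fun v => pdf v x) u 1.
  by move=> _ _; case: (is_derive_normal_pdf_mean u x).
pose G x := C * normal_pdf t (2 * s) x.
have G0 x : 0 <= G x by rewrite mulr_ge0 ?normal_pdf_ge0.
have intG : mu.-integrable A (EFin \o G).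
  have : mu.-integrable A (fun x => C%:E * (normal_pdf t (2 * s) x)%:E)%E.
    by apply: integrableZl => //; apply: integrableS (integrable_normal_pdf t (2 * s)).
  by apply: eq_integrable => // x _.
have Gub u x : `](t - 1), (t + 1)[%classic u -> A x ->
    `|partial1of2 (fun v => pdf v) u x| <= G x.
  rewrite /= in_itv/= => /andP[u1 u2] _; rewrite d1E; apply: dC.
  by rewrite ltr_norml; apply/andP; split; lra.
apply: DeriveDef.
  exact: (derivable_under_integral mA It intf derf G0 intG Gub).
rewrite -derive1E (differentiation_under_integral mA It intf derf G0 intG Gub).
by apply: eq_Rintegral => x _; rewrite d1E.
Qed.

End NormalFamily.

(** * Fisher information of a single bit *)

Section NormalFisher.
Context {R : realType} (s : R).
Hypothesis s_gt0 : 0 < s.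
Implicit Types (t u x c : R) (A : set (measurableTypeR R)).
Local Notation mu := (@lebesgue_measure R).
Local Notation pdf t := (normal_pdf t s).

Let s_neq0 : s != 0. Proof. by rewrite gt_eqF. Qed.
Let s2_gt0 : 0 < s ^+ 2. Proof. by rewrite exprn_gt0. Qed.

Lemma is_derive_integral_Nyc (f : R -> R) c : mu.-integrable setT (EFin \o f) ->
  continuous f -> is_derive c 1 (fun x => \int[mu]_(y in `]-oo, x]) f y) (f c).
Proof.
move=> intf cf; have cc1 : c < c + 1 by rewrite ltrDl.
have intfc : mu.-integrable `]-oo, (c + 1)] (EFin \o f) by exact: integrableS intf.
have [|d1 d2] := continuous_FTC1 cc1 intfc _ (cf c); first by rewrite ltNyr.
by apply: DeriveDef => //; rewrite -derive1E.
Qed.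

Let Phi t c := normal_mass s `]-oo, c]%classic t.

Lemma is_derive_Phi t c : is_derive c 1 (Phi t) (pdf t c).
Proof.
apply: is_derive_integral_Nyc; last exact: continuous_normal_pdf.
exact: integrable_normal_pdfS.
Qed.

Lemma Phi_limits t : Phi t c @[c --> +oo] --> (1 : R) /\ Phi t c @[c --> -oo] --> (0 : R).
Proof.
have mid : measurable_fun setT (idfun : measurableTypeR R -> R) by exact: measurable_id.
(* The identity has law [normal_prob t s], so [Phi t] is a distribution function and inherits the
   limits of one. *)
pose X : {RV (normal_prob t s) >-> R} := HB.pack (idfun : measurableTypeR R -> R)
  (isMeasurableFun.Build _ _ (measurableTypeR R) R idfun mid).
have XE c : cdf X c = (Phi t c)%:E by rewrite /Phi -normal_massE.
have XPhi : fine \o cdf X = Phi t by apply/funext => c; rewrite -[RHS]/(fine (Phi t c)%:E) -XE.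
by split; rewrite -[X in X c @[c --> _]]XPhi; apply: fine_cvg;
  [exact: cvg_cdfy1|exact: cvg_cdfNy0].
Qed.

(** The density is symmetric about [t], so the sum has derivative 0 in [u]; its constant value is
    the limit 1 at infinity. *)
Lemma Phi_sym t u : Phi t (t + u) + Phi t (t - u) = 1.
Proof.
pose h (u : R) : R := Phi t (t + u) + Phi t (t - u).
have dh (v : R) : is_derive v 1 h 0.
  have d1 : is_derive v 1 (fun u : R => t + u) (1 : R).
    apply: (is_derive_ext (is_deriveD (is_derive_cst t v 1) (is_derive_id v 1))) => //.
    by rewrite add0r.
  have d2 : is_derive v 1 (fun u : R => t - u) (- 1 : R).
    apply: (is_derive_ext (is_deriveB (is_derive_cst t v 1) (is_derive_id v 1))) => //.
    by rewrite sub0r.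
  have e1 := @is_derive1_comp _ (Phi t) (fun u => t + u) v _ _ (is_derive_Phi t (t + v)) d1.
  have e2 := @is_derive1_comp _ (Phi t) (fun u => t - u) v _ _ (is_derive_Phi t (t - v)) d2.
  apply: (is_derive_ext (is_deriveD e1 e2)) => //.
  rewrite !normal_pdf_expR// (_ : (t + v - t) ^+ 2 = (t - v - t) ^+ 2); first by ring.
  by ring.
have [Py PNy] := Phi_limits t.
have hy : h v @[v --> +oo] --> (1 : R).
  rewrite -[X in _ --> X]addr0; apply: cvgD.
    by apply: (cvg_comp (fun v => t + v) (Phi t)) Py; exact: cvg_addrl.
  apply: (cvg_comp (fun v => t - v) (Phi t)) PNy.
  by apply: (cvg_comp (fun v : R => - v) (fun v => t + v)); [apply/cvgNrNy; exact: cvg_id|exact: cvg_addrl_Ny].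
have hu : h v @[v --> +oo] --> h u.
  rewrite (_ : h = cst (h u)); first exact: cvg_cst.
  by apply/funext => v; exact: is_derive_0_is_cst.
by have := cvg_unique _ hu hy; apply.
Qed.

(** For [c >= t] this is [sqr_erf_le] for [Phi t] centred at [t]; when [c < t], [Phi_sym] reflects
    the threshold and the square absorbs the sign. *)
Lemma Phi_sqr_le t c :
  (2 * Phi t c - 1) ^+ 2 <= 1 - expR (- (c - t) ^+ 2 / s ^+ 2).
Proof.
pose G (u : R) : R := 2 * Phi t (t + u) - 1.
have G0 : G 0 = 0.
  by have := Phi_sym t 0; rewrite /G subr0 addr0; lra.
have dG u : is_derive u 1 G (2 * normal_peak s * expR (- u ^+ 2 / (2 * s ^+ 2))).
  have d1 : is_derive u 1 (fun u : R => t + u) (1 : R).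
    apply: (is_derive_ext (is_deriveD (is_derive_cst t u 1) (is_derive_id u 1))) => //.
    by rewrite add0r.
  have e1 := @is_derive1_comp _ (Phi t) (fun u => t + u) u _ _ (is_derive_Phi t (t + u)) d1.
  have e2 := is_deriveM (is_derive_cst (2 : R) u 1) e1.
  apply: (is_derive_ext (is_deriveB e2 (is_derive_cst (1 : R) u 1))) => //.
  by rewrite normal_pdf_expR// /GRing.scale/= (_ : t + u - t = u); ring.
have Gy : G u @[u --> +oo] --> (1 : R).
  have [Py _] := Phi_limits t.
  rewrite [X in _ --> X](_ : 1 = 2 * 1 - 1); last by ring.
  apply: cvgB; last exact: cvg_cst.
  apply: cvgM; first exact: cvg_cst.
  by apply: (cvg_comp (fun v => t + v) (Phi t)) Py; exact: cvg_addrl.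
have main := sqr_erf_le s_gt0 (normal_peak_ge0 s) G0 dG Gy.
have [tc|ct] := leP t c.
  have := main (c - t); rewrite subr_ge0 => /(_ tc).
  by rewrite /G (_ : t + (c - t) = c)//; ring.
have := main (t - c); rewrite subr_ge0 => /(_ (ltW ct)).
have := Phi_sym t (t - c); rewrite /G (_ : t - (t - c) = c); last by ring.
rewrite (_ : (t - c) ^+ 2 = (c - t) ^+ 2); last by ring.
move=> P1; rewrite (_ : 2 * Phi t (t + (t - c)) - 1 = - (2 * Phi t c - 1)) ?sqrrN//.
by lra.
Qed.

Lemma normal_massC A t : measurable A -> normal_mass s (~` A) t = 1 - normal_mass s A t.
Proof.
move=> mA; apply/EFin_inj; rewrite -normal_massE//; last exact: measurableC.
by rewrite EFinB -normal_massE// probability_setC.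
Qed.

Lemma normal_mass_ge0 A t : 0 <= normal_mass s A t.
Proof. by apply: Rintegral_ge0 => x _; exact: normal_pdf_ge0. Qed.

Lemma normal_mass_le1 A t : measurable A -> normal_mass s A t <= 1.
Proof. by move=> mA; rewrite -subr_ge0 -normal_massC// normal_mass_ge0. Qed.

Lemma dnormal_massC A t : measurable A -> dnormal_mass s (~` A) t = - dnormal_mass s A t.
Proof.
move=> mA; have d1 := is_derive_normal_mass s_gt0 t mA.
have d2 := is_derive_normal_mass s_gt0 t (measurableC mA).
have d3 : is_derive t 1 (normal_mass s (~` A)) (- dnormal_mass s A t).
  apply: (is_derive_ext (is_deriveB (is_derive_cst (1 : R) t 1) d1)) => [x|].
    by rewrite normal_massC.
  by rewrite sub0r.
by case: d2 => _ <-; case: d3.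
Qed.

Lemma dnormal_mass_itv t c : dnormal_mass s `]-oo, c]%classic t = - pdf t c.
Proof.
pose h (c : R) : R := dnormal_mass s `]-oo, c]%classic t + pdf t c.
have dh (v : R) : is_derive v 1 h 0.
  have e1 := is_derive_integral_Nyc v (integrable_dnormal_pdf s_gt0 t measurableT)
    (@continuous_dnormal_pdf _ _ s_gt0 t).
  by apply: (is_derive_ext (is_deriveD e1 (is_derive_normal_pdf s_gt0 t v))) => //; rewrite subrr.
(* The base point is [t] because [dnormal_pdf s t] is nonnegative to its right, as the fundamental
   theorem on a half-line requires. *)
suff h0 : h t = 0 by apply/eqP; rewrite -addr_eq0 -[X in X == _]/(h c) (is_derive_0_is_cst _ t dh) h0.
rewrite /h -[X in dnormal_mass s X](setCK) dnormal_massC; last exact: measurableC.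
rewrite setCitvl /dnormal_mass Rintegral_itv_obnd_cbnd; last exact: integrable_dnormal_pdf.
rewrite (@Rintegral_ge0_continuous_FTC2y _ (dnormal_pdf s t) (\- pdf t) t 0).
- by rewrite sub0r !opprK addNr.
- move=> x tx; rewrite /dnormal_pdf mulr_ge0 ?normal_pdf_ge0// divr_ge0 ?subr_ge0//.
  exact: ltW.
- by apply: continuous_subspaceT; exact: continuous_dnormal_pdf.
- rewrite -oppr0; apply: cvgN.
  rewrite (_ : pdf t = fun x => normal_peak s * expR (- (x - t) ^+ 2 / (2 * s ^+ 2))); last first.
    by apply/funext => x; rewrite normal_pdf_expR.
  rewrite -[X in _ --> X](mulr0 (normal_peak s)); apply: cvgM; first exact: cvg_cst.
  have s20 : 0 < 2 * s ^+ 2 by rewrite mulr_gt0.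
  apply: (cvg_comp (fun x => x - t) (fun x => expR (- x ^+ 2 / (2 * s ^+ 2)))) (expR_sqr_small s20).
  exact: cvg_addrr.
- by move=> x _; apply: derivableN; case: (is_derive_normal_pdf s_gt0 t x).
- by apply: cvg_at_right_filter; apply: cvgN; exact: continuous_normal_pdf.
- move=> x _; rewrite derive1E deriveN; last by case: (is_derive_normal_pdf s_gt0 t x).
  by case: (is_derive_normal_pdf s_gt0 t x) => _ ->; rewrite opprK.
Qed.

(** A Neyman-Pearson argument: the left side is the integral over [A] of
    [(x - c) / s ^+ 2 * pdf t x], which has the sign of [x - c], so no set does better than the
    half-line beyond [c]. *)
Lemma dnormal_mass_le A t c : measurable A ->
  dnormal_mass s A t - (c - t) / s ^+ 2 * normal_mass s A t <=
  pdf t c - (c - t) / s ^+ 2 * (1 - Phi t c).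
Proof.
move=> mA; pose f x := dnormal_pdf s t x - (c - t) / s ^+ 2 * pdf t x.
have intk B : measurable B -> mu.-integrable B (EFin \o (fun x => (c - t) / s ^+ 2 * pdf t x)).
  move=> mB; have : mu.-integrable B (fun x => ((c - t) / s ^+ 2)%:E * (pdf t x)%:E)%E.
    by apply: integrableZl => //; exact: integrable_normal_pdfS.
  exact: eq_integrable.
have fE B : measurable B -> \int[mu]_(x in B) f x =
    dnormal_mass s B t - (c - t) / s ^+ 2 * normal_mass s B t.
  move=> mB; rewrite /f RintegralB//; last 2 first.
  - exact: integrable_dnormal_pdf.
  - exact: intk.
  by rewrite RintegralZl//; exact: integrable_normal_pdfS.
have intf B : measurable B -> mu.-integrable B (EFin \o f).
  move=> mB.
  have := integrableB mB (integrable_dnormal_pdf s_gt0 t mB) (intk _ mB).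
  exact: eq_integrable.
pose I : set (measurableTypeR R) := `]c, +oo[%classic.
have IE : I = ~` `]-oo, c] by rewrite setCitvl.
have mI : measurable I by exact: measurable_itv.
have -> : pdf t c - (c - t) / s ^+ 2 * (1 - Phi t c) = \int[mu]_(x in I) f x.
  by rewrite fE// IE dnormal_massC// normal_massC// dnormal_mass_itv opprK.
rewrite -fE// Rintegral_mkcond [leRHS]Rintegral_mkcond.
have intr (B : set (measurableTypeR R)) : measurable B -> mu.-integrable setT (EFin \o (f \_ B)).
  by move=> mB; rewrite -restrict_EFin; apply/(integrable_mkcond _ mB); exact: intf.
apply: le_Rintegral => //; [exact: intr|exact: intr|move=> x _].
have fx : f x = (x - c) / s ^+ 2 * pdf t x by rewrite /f /dnormal_pdf; ring.
have s2V : 0 <= (s ^+ 2)^-1 by rewrite invr_ge0 ltW.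
have Ix : (x \in I) = (c < x).
  by apply/idP/idP; rewrite inE /I/= in_itv/= andbT.
rewrite !patchE Ix; case: ifPn => xA; case: ltP => // xc.
- by rewrite fx mulr_le0_ge0 ?normal_pdf_ge0// mulr_le0_ge0// subr_le0.
- by rewrite fx !mulr_ge0 ?normal_pdf_ge0// subr_ge0 ltW.
Qed.

(* Minimising over the threshold c of dnormal_mass_le: the choice
   c - t = - v / (pi d) makes both sides proportional. *)
Lemma fisher_normal_mass A t : measurable A ->
  dnormal_mass s A t ^+ 2 <=
  2 / (pi * s ^+ 2) * (normal_mass s A t * (1 - normal_mass s A t)).
Proof.
(* Complementation changes the sign of the derivative and exchanges [q] with [1 - q]. *)
wlog : A / 0 <= dnormal_mass s A t => [H mA|].
  have [d0|/ltW d0] := leP 0 (dnormal_mass s A t); first exact: H.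
  have := H (~` A); rewrite dnormal_massC// normal_massC// oppr_ge0.
  move=> /(_ d0 (measurableC mA)); rewrite sqrrN => /le_trans -> //.
  by rewrite subKr [X in _ * X]mulrC.
set d := dnormal_mass s A t; set q := normal_mass s A t => d0 mA.
have pi0 : 0 < pi :> R := pi_gt0 R.
have PE := sqr_normal_peak s_gt0; move: (@pi R) pi0 PE => p p0 PE.
have k0 : 0 < 2 / (p * s ^+ 2) by rewrite divr_gt0// mulr_gt0.
have q0 : 0 <= q := normal_mass_ge0 _ _; have q1 : q <= 1 := normal_mass_le1 _ mA.
move: d0; rewrite le_eqVlt => /predU1P[<-|d0].
  by rewrite expr2 mulr0; apply: mulr_ge0; [exact: ltW|rewrite mulr_ge0 ?subr_ge0].
have H c : d - (c - t) / s ^+ 2 * q <= pdf t c - (c - t) / s ^+ 2 * (1 - Phi t c).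
  exact: dnormal_mass_le.
clearbody d q; have dn : d != 0 by rewrite gt_eqF.
have pn : p != 0 by rewrite gt_eqF.
pose v := 2 * q - 1; pose u : R := - v / (p * d); pose c : R := t + u.
have := H c.
have := Phi_sqr_le t c; set G := 2 * Phi t c - 1.
have PhiE : 1 - Phi t c = (1 - G) / 2 by rewrite /G; field.
rewrite PhiE normal_pdf_expR// (_ : c - t = u); last by rewrite /c; ring.
set e := expR (- u ^+ 2 / (2 * s ^+ 2)); set P : R := normal_peak s.
have -> : expR (- u ^+ 2 / s ^+ 2) = e ^+ 2.
  by rewrite [RHS]expr2 /e -expRD; congr expR; field.
move=> Ge dle.
rewrite -/P in PE.
(* In terms of [v] the goal reads [w <= 1]; it will come from [w ^+ 2 <= w]. *)
pose w := 2 * p * s ^+ 2 * d ^+ 2 + v ^+ 2.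
pose r := P * e + u / (2 * s ^+ 2) * G.
have w0 : 0 <= w by rewrite addr_ge0 ?sqr_ge0// !mulr_ge0 ?sqr_ge0// ltW.
have wr : w <= 2 * p * s ^+ 2 * d * r.
  have -> : w = 2 * p * s ^+ 2 * d * (d - u / (2 * s ^+ 2) * v).
    by rewrite /w /u; field; rewrite ?s_neq0 ?dn ?pn.
  rewrite ler_pM2l; last by rewrite !mulr_gt0.
  rewrite /r lerBlDr.
  have -> : P * e + u / (2 * s ^+ 2) * G + u / (2 * s ^+ 2) * v =
    (P * e - u / s ^+ 2 * ((1 - G) / 2)) + u / s ^+ 2 * q by rewrite /v; field.
  by rewrite -lerBlDr.
(* Cauchy-Schwarz for the vectors [(P, u / (2 s^2))] and [(e, G)], the second of norm at most 1 by
   [Phi_sqr_le]. *)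
have r2 : r ^+ 2 <= P ^+ 2 + (u / (2 * s ^+ 2)) ^+ 2.
  rewrite /r; set a := u / _.
  have : (P ^+ 2 + a ^+ 2) * (e ^+ 2 + G ^+ 2) <= (P ^+ 2 + a ^+ 2) * 1.
    by rewrite ler_wpM2l ?addr_ge0 ?sqr_ge0//; lra.
  have := sqr_ge0 (P * G - a * e); nra.
(* As [P ^+ 2 = 1 / (2 p s^2)], the choice of [u] turns the bound on the square of [2 p s^2 d r]
   into [w] itself. *)
have ww : w ^+ 2 <= w.
  apply: (@le_trans _ _ ((2 * p * s ^+ 2 * d * r) ^+ 2)).
    by rewrite ler_sqr ?nnegrE// (le_trans w0).
  rewrite exprMn; apply: (@le_trans _ _ ((2 * p * s ^+ 2 * d) ^+ 2 * (P ^+ 2 + (u / (2 * s ^+ 2)) ^+ 2))).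
    by rewrite ler_wpM2l ?sqr_ge0.
  by rewrite PE /w /u le_eqVlt; apply/orP; left; apply/eqP; field; rewrite ?s_neq0 ?dn ?pn.
have w1 : w <= 1.
  rewrite leNgt; apply/negP => w1; move: ww; rewrite expr2 leNgt => /negP; apply.
  by rewrite -[ltLHS]mulr1 ltr_pM2l// (lt_trans _ w1).
have -> : 2 / (p * s ^+ 2) * (q * (1 - q)) = (1 - v ^+ 2) / (2 * p * s ^+ 2).
  by rewrite /v; field; rewrite ?s_neq0 ?pn.
rewrite ler_pdivlMr; last by rewrite !mulr_gt0.
by move: w1; rewrite /w; lra.
Qed.

End NormalFisher.

(** * Likelihood and Fisher information of a transcript *)

Section Likelihood.
Context {R : realType} (s : R).
Hypothesis s_gt0 : 0 < s.
Variable S : seq bool -> set (measurableTypeR R).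
Hypothesis mS : forall h, measurable (S h).
Implicit Types (t : R) (h m : seq bool) (b : bool).

Definition one_bit_info : R := 2 / (pi * s ^+ 2).

Definition cell h b := if b then S h else ~` S h.

Lemma measurable_cell h b : measurable (cell h b).
Proof. by case: b => /=; [exact: mS|exact: measurableC]. Qed.

(** The probability, at parameter [t], that the messages following the history [h] read [m]. The
    history is carried along because the next acceptance set depends on it. *)
Fixpoint lik h m t : R :=
  if m is b :: m' then normal_mass s (cell h b) t * lik (rcons h b) m' t else 1.

Fixpoint dlik h m t : R :=
  if m is b :: m' then dnormal_mass s (cell h b) t * lik (rcons h b) m' t +
    normal_mass s (cell h b) t * dlik (rcons h b) m' t else 0.

Lemma is_derive_lik h m t : is_derive t 1 (lik h m) (dlik h m t).
Proof.
elim: m h => [|b m ih] h /=; first exact: is_derive_cst.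
have d1 := is_derive_normal_mass s_gt0 t (measurable_cell h b).
apply: (is_derive_ext (is_deriveM d1 (ih (rcons h b)))) => //.
by rewrite /GRing.scale/=; ring.
Qed.

Lemma lik_ge0 h m t : 0 <= lik h m t.
Proof. by elim: m h => //= b m ih h; rewrite mulr_ge0 ?normal_mass_ge0. Qed.

Lemma lik_le1 h m t : lik h m t <= 1.
Proof.
elim: m h => //= b m ih h; rewrite mulr_ile1 ?lik_ge0 ?normal_mass_ge0//.
exact: normal_mass_le1 (measurable_cell _ _).
Qed.

Lemma one_bit_info_gt0 : 0 < one_bit_info.
Proof. by rewrite divr_gt0// mulr_gt0 ?pi_gt0// exprn_gt0. Qed.

(** By the information bound the derivative vanishes with the mass, so that setting quotients by a
    zero likelihood to 0 loses nothing. *)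
Lemma dnormal_mass_eq0 h b t :
  normal_mass s (cell h b) t = 0 -> dnormal_mass s (cell h b) t = 0.
Proof.
move=> q0; have := fisher_normal_mass s_gt0 t (measurable_cell h b).
by rewrite q0 mul0r mulr0 => /(conj (sqr_ge0 (dnormal_mass s (cell h b) t)))/andP;
  rewrite -eq_le eq_sym sqrf_eq0 => /eqP.
Qed.

Lemma dlik_eq0 h m t : lik h m t = 0 -> dlik h m t = 0.
Proof.
elim: m h => [|b m ih] h //= /eqP; rewrite mulf_eq0 => /orP[]/eqP l0.
  by rewrite l0 dnormal_mass_eq0// !mul0r addr0.
by rewrite l0 ih// !mulr0 addr0.
Qed.

Fixpoint bits n : seq (seq bool) :=
  if n is n'.+1 then map (cons true) (bits n') ++ map (cons false) (bits n')
  else [:: [::]].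

Lemma mem_bits n m : (m \in bits n) = (size m == n).
Proof.
elim: n m => [|n ih] [|b m] //=.
- by rewrite mem_cat; apply/negP => /orP[] /mapP[].
- rewrite mem_cat eqSS -ih; case: b.
    rewrite mem_map; last by move=> ? ? [].
    by apply/orb_idr => /mapP[].
  rewrite [X in _ || X]mem_map; last by move=> ? ? [].
  by apply/orb_idl => /mapP[].
Qed.

Lemma uniq_bits n : uniq (bits n).
Proof.
elim: n => //= n ih; rewrite cat_uniq !map_inj_uniq ?ih/= ?andbT.
- by apply/hasPn => _ /mapP[m _ ->]; apply/negP => /mapP[].
- by move=> ? ? [].
- by move=> ? ? [].
Qed.

Lemma sum_bitsS n (F : seq bool -> R) : \sum_(m <- bits n.+1) F m =
  \sum_(m <- bits n) F (true :: m) + \sum_(m <- bits n) F (false :: m).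
Proof. by rewrite big_cat/= !big_map. Qed.

Let massN h t : normal_mass s (cell h false) t = 1 - normal_mass s (cell h true) t.
Proof. exact: normal_massC. Qed.

Let dmassN h t : dnormal_mass s (cell h false) t = - dnormal_mass s (cell h true) t.
Proof. exact: dnormal_massC. Qed.

Lemma sum_lik n h t : \sum_(m <- bits n) lik h m t = 1.
Proof.
elim: n h => [|n ih] h; first by rewrite big_seq1.
by rewrite sum_bitsS/= -!mulr_sumr !ih massN; ring.
Qed.

Lemma sum_dlik n h t : \sum_(m <- bits n) dlik h m t = 0.
Proof.
elim: n h => [|n ih] h; first by rewrite big_seq1.
by rewrite sum_bitsS/= !big_split/= -!mulr_sumr !ih !sum_lik dmassN; ring.
Qed.

(** Chain rule for the information. The middle term is linear in [dlik] and disappears on summation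
    over [m]. If a factor of the likelihood is zero, both sides are 0. *)
Lemma info_cons h b m t : dlik h (b :: m) t ^+ 2 / lik h (b :: m) t =
  dnormal_mass s (cell h b) t ^+ 2 / normal_mass s (cell h b) t * lik (rcons h b) m t
  + 2 * dnormal_mass s (cell h b) t * dlik (rcons h b) m t
  + normal_mass s (cell h b) t * (dlik (rcons h b) m t ^+ 2 / lik (rcons h b) m t).
Proof.
rewrite /=; have := @dnormal_mass_eq0 h b t; have := @dlik_eq0 (rcons h b) m t.
move: (normal_mass _ _ _) (dnormal_mass _ _ _) (lik _ _ _) (dlik _ _ _) => q d l k.
have [-> /(_ erefl)-> _|l0 _] := eqVneq l 0; first by rewrite !(mulr0, invr0, mul0r, expr2, addr0).
have [-> /(_ erefl)->|q0 _] := eqVneq q 0; first by rewrite !(mulr0, invr0, mul0r, expr2, addr0).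
by field; rewrite l0 q0.
Qed.

Lemma info_bit h t : \sum_(b <- [:: true; false])
  dnormal_mass s (cell h b) t ^+ 2 / normal_mass s (cell h b) t <= one_bit_info.
Proof.
rewrite !big_cons big_nil addr0 massN dmassN sqrrN.
have := fisher_normal_mass s_gt0 t (mS h).
have q0 := normal_mass_ge0 s (S h) t; have q1 := normal_mass_le1 s t (mS h).
rewrite /= -/one_bit_info; have k0 := one_bit_info_gt0.
move: (normal_mass _ _ _) (dnormal_mass _ _ _) q0 q1 => q d q0 q1 dk.
have [qz|qn] := eqVneq q 0.
  have d0 : d ^+ 2 <= 0 by move: dk; rewrite qz mul0r mulr0.
  have -> : d ^+ 2 = 0 by apply/eqP; rewrite eq_le d0 sqr_ge0.
  by rewrite !mul0r addr0 ltW.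
have [qz|rn] := eqVneq (1 - q) 0.
  have d0 : d ^+ 2 <= 0 by move: dk; rewrite qz !mulr0.
  have -> : d ^+ 2 = 0 by apply/eqP; rewrite eq_le d0 sqr_ge0.
  by rewrite !mul0r addr0 ltW.
have qp : 0 < q by rewrite lt_neqAle eq_sym qn.
have rp : 0 < 1 - q by rewrite lt_neqAle eq_sym rn subr_ge0.
have -> : d ^+ 2 / q + d ^+ 2 / (1 - q) = d ^+ 2 / (q * (1 - q)) by field; rewrite ?qn ?rn.
by rewrite ler_pdivrMr// mulr_gt0.
Qed.

(** The first bit contributes at most [one_bit_info]; the rest contributes the average of the two
    conditional informations, weighted by the masses of the two cells, to which induction
    applies. *)
Lemma sum_info n h t :
  \sum_(m <- bits n) dlik h m t ^+ 2 / lik h m t <= n%:R * one_bit_info.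
Proof.
elim: n h => [|n ih] h; first by rewrite big_seq1 /= expr2 !mul0r.
rewrite sum_bitsS; under eq_bigr do rewrite info_cons.
under [X in _ + X]eq_bigr do rewrite info_cons.
rewrite !big_split/= -!mulr_sumr !sum_lik !sum_dlik !mulr0 !mulr1 !addr0.
have := info_bit h t; rewrite !big_cons big_nil addr0.
have := ih (rcons h true); have := ih (rcons h false).
have := normal_mass_ge0 s (cell h true) t; have := normal_mass_ge0 s (cell h false) t.
rewrite massN; set q := normal_mass _ _ _; move: (\sum_(m <- _) _) (\sum_(m <- _) _) => A B.
move: (one_bit_info) (dnormal_mass _ _ _ ^+ 2 / _) (dnormal_mass _ _ _ ^+ 2 / _) => k x y.
by rewrite mulrS; nra.
Qed.

(** A bound uniform in [t], needed for the integration by parts. It keeps a single term of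
    [sum_info] and uses that its denominator is at most 1. *)
Lemma dlik_sqr_le n m h t : m \in bits n -> dlik h m t ^+ 2 <= n%:R * one_bit_info.
Proof.
move=> mn; apply: le_trans (sum_info n h t).
rewrite (big_rem m mn)/= (@le_trans _ _ (dlik h m t ^+ 2 / lik h m t))//.
  have [l0|l0] := eqVneq (lik h m t) 0; first by rewrite dlik_eq0// expr2 !mul0r.
  have lp : 0 < lik h m t by rewrite lt_neqAle eq_sym l0 lik_ge0.
  by rewrite ler_pdivlMr// ler_piMr ?sqr_ge0// lik_le1.
by rewrite lerDl sumr_ge0// => i _; rewrite divr_ge0 ?sqr_ge0 ?lik_ge0.
Qed.

End Likelihood.

(** * Integration against a density, and monotonicity of integrals *)

Section MeasureTools.
Local Open Scope ereal_scope.

(** Having the same integrals over all measurable sets, [k] agrees almost everywhere with the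
    Radon-Nikodym derivative, for which the change of variables is known. *)
Lemma ge0_integral_density (d : measure_display) (T : measurableType d)
    (R : realType) (mu : {sigma_finite_measure set T -> \bar R})
    (nu : {finite_measure set T -> \bar R}) (k : T -> \bar R) :
  measurable_fun setT k -> (forall x, 0 <= k x) ->
  (forall B, measurable B -> nu B = \int[mu]_(x in B) k x) ->
  forall f : T -> \bar R, (forall x, 0 <= f x) -> measurable_fun setT f ->
  \int[nu]_x f x = \int[mu]_x (f x * k x).
Proof.
move=> mk k0 nuk f f0 mf.
have numu : nu `<< mu.
  apply/null_content_dominatesP => A mA A0; rewrite nuk//.
  apply: null_set_integral => //; exact: measurable_funTS.
rewrite -(Radon_Nikodym_SigmaFinite.change_of_variables numu)//.
have mRN := measurable_int mu (Radon_Nikodym_SigmaFinite.f_integrable numu).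
apply: ae_eq_integral => //; [exact: emeasurable_funM|exact: emeasurable_funM|].
apply: ae_eqe_mul2l; apply: integral_ae_eq => //.
  exact: Radon_Nikodym_SigmaFinite.f_integrable.
by move=> A _ mA; rewrite -nuk// -Radon_Nikodym_SigmaFinite.f_integral.
Qed.

(* The integral of a nonnegative function is a supremum over simple functions
   below it, hence monotone without any measurability assumption. *)
Lemma ge0_le_integral_nonmeas (d : measure_display) (T : measurableType d)
    (R : realType) (mu : {measure set T -> \bar R}) (f g : T -> \bar R) :
  (forall x, 0 <= f x) -> (forall x, f x <= g x) ->
  \int[mu]_x f x <= \int[mu]_x g x.
Proof.
move=> f0 fg; have g0 x : 0 <= g x by exact: le_trans (f0 x) (fg x).
rewrite !ge0_integralTE//; apply: le_ereal_sup => _ [h hf <-]; exists h => // x.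
exact: le_trans (hf x) (fg x).
Qed.

End MeasureTools.

(** * A measurable version of the derivative *)

Section MeasurableDerivative.
Context {R : realType}.

(** The upper limit of the difference quotients with steps [1 / (n + 1)] is measurable whether or
    not the derivative exists, and equals it where it does. *)
Lemma measurable_derivative (p : R -> R) : continuous p ->
  exists2 g : R -> R, measurable_fun setT g &
    forall x d : R, is_derive x 1 p d -> g x = d.
Proof.
move=> cp.
pose D n (x : R) : \bar R := (n.+1%:R * (p (x + n.+1%:R^-1) - p x))%:E.
exists (fun x => fine (limn_esup (D ^~ x))).
  apply: measurableT_comp => //.
  apply: measurable_fun_limn_esup => n; apply/measurable_EFinP.
  apply: continuous_measurable_fun => x.
  apply: cvgM; first exact: cvg_cst.
  apply: cvgB; last exact: cp.
  apply: (cvg_comp (fun x => x + n.+1%:R^-1) p); last exact: cp.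
  by apply: cvgD; [exact: cvg_id|exact: cvg_cst].
move=> x d [dp dE].
suff Dd : D ^~ x @ \oo --> d%:E by rewrite is_cvg_limn_esupE ?(cvg_lim _ Dd)//; apply/cvg_ex; eexists; exact: Dd.
apply: cvg_EFin; first exact: nearW.
move: dp => /cvg_ex[/= l pl]; have ld : l = d.
  by rewrite -dE; apply/esym/cvg_lim.
rewrite -ld; move/cvgr_dnbhsP : pl => /(_ (fun n => n.+1%:R^-1)).
move=> H; rewrite (_ : _ \o _ = fun n =>
  (n.+1%:R^-1 : R)^-1 *: (p ((n.+1%:R^-1 : R)%:A + x) - p x)); last first.
  by apply/funext => n /=; rewrite invrK [_%:A]mulr1 (addrC _ x).
apply: H; split; last exact: cvg_harmonic.
by move=> n; rewrite invr_neq0.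
Qed.

End MeasurableDerivative.

(** * Integrals over moving sets, and integrable functions near infinity *)

Section IntegralTools.
Context {R : realType}.
Local Notation mu := (@lebesgue_measure R).
Implicit Types (f h q : R -> R).

(** Dominated convergence in a form that serves two purposes: blocks running off to infinity, with
    [h = 0], and intervals exhausting the support, with [h = f]. *)
Lemma cvg_Rintegral_sets f h (I : nat -> set (measurableTypeR R)) :
  mu.-integrable setT (EFin \o f) -> (forall n, measurable (I n)) ->
  (forall x, \forall n \near \oo, (f \_ (I n)) x = h x) ->
  \int[mu]_(x in I n) f x @[n --> \oo] --> \int[mu]_x h x.
Proof.
move=> intf mI fh.
have intfI n : mu.-integrable setT (EFin \o (f \_ (I n))).
  rewrite -restrict_EFin; apply/(integrable_mkcond _ (mI n)).
  exact: integrableS intf.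
have mf n : measurable_fun setT (fun x => ((f \_ (I n)) x)%:E).
  exact: measurable_int (intfI n).
have cvf x : setT x -> ((f \_ (I n)) x)%:E @[n --> \oo] --> (h x)%:E.
  move=> _; apply: cvg_near_cst; near=> n; congr EFin; near: n; exact: fh.
have dom n x : setT x -> (`|((f \_ (I n)) x)%:E| <= `|(f x)%:E|)%E.
  by move=> _; rewrite lee_fin patchE; case: ifPn => //; rewrite normr0.
have inth : mu.-integrable setT (EFin \o h).
  apply: (@le_integrable _ _ _ mu setT measurableT _ (EFin \o f)) => //.
    exact: emeasurable_fun_cvg mf cvf.
  move=> x _ /=; rewrite lee_fin.
  have [n _ /(_ n (leqnn n)) <-] := fh x.
  by rewrite patchE; case: ifPn => //; rewrite normr0.
under eq_fun do rewrite Rintegral_mkcond.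
apply: fine_cvg; rewrite [X in _ --> X](_ : _ = \int[mu]_x (h x)%:E)%E; last first.
  by rewrite /Rintegral fineK//; exact: integrable_fin_num inth.
apply: (@dominated_cvg _ _ _ mu setT measurableT _ _ (fun x => `|(f x)%:E|)%E) => //.
by have := integrable_abse intf; apply: eq_integrable.
Unshelve. all: by end_near. Qed.

Definition end_block (right : bool) (k : nat) : set (measurableTypeR R) :=
  if right then `[k%:R, 2 * k%:R]%classic else `[- (2 * k%:R), - k%:R]%classic.

(* If |x - e| q x stayed above eps near an end, q would put mass at least
   eps / 3 on each block [k, 2k]. *)
Lemma integrable_end_small q (e : R) (right : bool) : (forall x, 0 <= q x) ->
  mu.-integrable setT (EFin \o q) ->
  forall eps X : R, 0 < eps ->
  exists2 b, X <= (if right then b else - b) & `|(b - e) * q b| <= eps.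
Proof.
move=> q0 intq eps X eps0; apply: contrapT => Hno.
have big b : X <= (if right then b else - b) -> eps < `|(b - e) * q b|.
  by move=> Xb; rewrite ltNge; apply/negP => h; apply: Hno; exists b.
have mJ k : measurable (end_block right k).
  by rewrite /end_block; case: (right); exact: measurable_itv.
have : \int[mu]_(x in end_block right k) q x @[k --> \oo] --> \int[mu]_x (cst 0 x : R).
  apply: cvg_Rintegral_sets => // x; near=> k.
  rewrite patchE; case: ifPn => //; rewrite inE => Jx; exfalso.
  have xk : `|x| < k%:R.
    by near: k; apply: filterS (nbhs_infty_gtr `|x|) => k.
  move: xk; rewrite ltr_norml => /andP[]; move: Jx.
  by rewrite /end_block; case: (right); rewrite /= in_itv/= => /andP[]; lra.
rewrite Rintegral_cst// mul0r => /cvgrPdist_lt/(_ (eps / 3)).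
rewrite divr_gt0// => /(_ isT)[N _ HN].
(* [X <= k] puts the block in the range of [big], and [|e| <= k] gives [|x - e| <= 3 k] on it; hence
   the 3 in [eps / 3]. *)
have [k [Nk k1 kX ke]] : exists k : nat, [/\ (N <= k)%N, 1 <= k%:R :> R, X <= k%:R & `|e| <= k%:R].
  have [k1 _ h1] := nbhs_infty_ger X; have [k2 _ h2] := nbhs_infty_ger `|e|.
  exists (maxn (maxn k1 k2) (maxn N 1)); split.
  - by rewrite !leq_max leqnn !orbT.
  - by rewrite (ler_nat _ 1) !leq_max leqnn !orbT.
  - by apply: h1 => /=; rewrite !leq_max leqnn.
  - by apply: h2 => /=; rewrite !leq_max leqnn orbT.
have := HN k Nk; rewrite /= sub0r normrN => lt3.
have k0 : 0 < k%:R :> R by apply: lt_le_trans k1.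
have Jq x : end_block right k x -> eps / 3 / k%:R <= q x.
  move=> Jx; have : X <= (if right then x else - x) /\ `|x - e| <= 3 * k%:R.
    move: Jx; rewrite /end_block; move: ke; rewrite ler_norml => /andP[ke1 ke2].
    case: (right); rewrite /= in_itv/= => /andP[? ?]; split; rewrite ?ler_norml;
      try (apply/andP; split); lra.
  move=> [/big + xe]; rewrite normrM (ger0_norm (q0 x)) => lt.
  rewrite ler_pdivrMr// ler_pdivrMr//.
  have : `|x - e| * q x <= 3 * k%:R * q x by rewrite ler_wpM2r.
  lra.
have muJ : mu (end_block right k) = k%:R%:E.
  by rewrite /end_block; case: (right); rewrite lebesgue_measure_itv/= lte_fin;
    (case: ltP => h; [rewrite -EFinB; congr EFin; ring|exfalso; lra]).
have muJoo : (mu (end_block right k) < +oo)%E by rewrite muJ ltry.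
have : \int[mu]_(x in end_block right k) (cst (eps / 3 / k%:R) x) <= \int[mu]_(x in end_block right k) q x.
  apply: le_Rintegral => //.
  - by apply: measurable_bounded_integrable => //; exact: bounded_cst.
  - exact: integrableS intq.
rewrite Rintegral_cst// [fine _](_ : _ = k%:R); last exact: (congr1 fine muJ).
rewrite divfK ?gt_eqF//.
move: lt3; rewrite ltr_norml => /andP[_]; lra.
Unshelve. all: by end_near. Qed.

End IntegralTools.

(** * Sequences approaching the end of an open interval *)

Section OpenIntervalEnds.
Context {R : realType}.
Implicit Types (U : set R) (F : R -> R) (x y : R).

Lemma open_itv_above U x : open U -> U x -> exists2 y, x < y & U y.
Proof.
move=> /(_ x) /[apply] /nbhs_ballP[e /= e0 eU]; exists (x + e / 2).
  by rewrite ltrDl divr_gt0.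
by apply: eU; rewrite /ball/= opprD addNKr normrN gtr0_norm ?divr_gt0//; lra.
Qed.

(** If [U] is unbounded above, the last hypothesis supplies the points. Otherwise [sup U] lies
    outside the open set [U], so [F] is zero there and small nearby by continuity. *)
Lemma right_end U F x0 : open U -> is_interval U -> U x0 -> continuous F ->
  (forall x, ~ U x -> F x = 0) ->
  (forall eps X : R, 0 < eps -> exists2 b, X <= b & `|F b| <= eps) ->
  exists b : nat -> R, [/\ forall k, U (b k), F (b k) @[k --> \oo] --> (0 : R) &
    forall x, U x -> \forall k \near \oo, x < b k].
Proof.
move=> oU iU Ux0 cF F0 Finf.
(* The final alternative expresses the approach to the right end, whether that end is infinite or
   finite. *)
have [b Hb] : {b : nat -> R & forall k, [/\ U (b k), `|F (b k)| <= k.+1%:R^-1 &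
    k%:R <= b k \/ forall y, U y -> y <= b k + k.+1%:R^-1]}.
  apply: (@choice _ _ (fun k b => [/\ U b, `|F b| <= k.+1%:R^-1 &
    k%:R <= b \/ forall y, U y -> y <= b + k.+1%:R^-1])) => k.
  have k0 : 0 < k.+1%:R^-1 :> R by rewrite invr_gt0.
  have [ubU|nubU] := pselect (has_ubound U); last first.
    have Uge y : x0 <= y -> U y.
      move=> x0y; apply: contrapT => nUy; apply: nubU; exists y => z Uz.
      rewrite leNgt; apply/negP => yz; apply: nUy; apply: (iU x0 z) => //.
      by rewrite x0y ltW.
    have [b] := Finf _ (Num.max x0 k%:R) k0; rewrite ge_max => /andP[x0b kb] Fb.
    by exists b; split => //; [exact: Uge|left].
  have U0 : U !=set0 by exists x0.
  have hsU : has_sup U by [].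
  have nUs : ~ U (sup U).
    move=> Us; have [y sy Uy] := open_itv_above oU Us.
    by have := ub_le_sup ubU Uy; rewrite leNgt sy.
  have Fs : F (sup U) = 0 by exact: F0.
  have /cvgrPdist_le/(_ _ k0) := cF (sup U); rewrite Fs => /nbhs_ballP[e /= e0 He].
  have m0 : 0 < Num.min e k.+1%:R^-1 by rewrite lt_min e0.
  have [b Ub bs] := sup_adherent m0 hsU; exists b; split => //.
  - have := He b; rewrite sub0r normrN; apply.
    rewrite /ball/= ger0_norm; last by rewrite subr_ge0; exact: ub_le_sup.
    by rewrite ltrBlDl -ltrBlDr (le_lt_trans _ bs)// lerB// ge_min lexx.
  - right=> y Uy; apply: le_trans (ub_le_sup ubU Uy) _.
    rewrite -lerBlDr; apply: ltW; apply: le_lt_trans bs; rewrite lerB//.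
    by rewrite ge_min lexx orbT.
exists b; split.
- by move=> k; case: (Hb k).
- apply/cvgrPdist_le => e e0; near=> k; rewrite sub0r normrN.
  have [_ + _] := Hb k; move=> /le_trans; apply; apply: ltW.
  by near: k; exact: near_infty_natSinv_lt (PosNum e0).
- move=> x Ux; have [y xy Uy] := open_itv_above oU Ux.
  have yx0 : 0 < y - x by rewrite subr_gt0.
  near=> k; have [_ _ [kb|/(_ y Uy) yb]] := Hb k.
    by apply: lt_le_trans kb; near: k; apply: filterS (nbhs_infty_gtr x).
  have : k.+1%:R^-1 < y - x by near: k; exact: near_infty_natSinv_lt (PosNum yx0).
  by move: (k.+1%:R^-1) yb => z; lra.
Unshelve. all: by end_near. Qed.

End OpenIntervalEnds.

(** * Integration by parts against an absolutely continuous density *)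

Section VanTreesIdentity.
Context {R : realType}.
Local Notation mu := (@lebesgue_measure R).
Implicit Types (a b x y : R) (f g h w p : R -> R).

Lemma seq_abs_contM a b p w (M K : R) : a <= b -> 0 <= M -> 0 <= K ->
  seq_abs_cont a b p ->
  (forall x, a <= x <= b -> `|p x| <= M) ->
  (forall x, a <= x <= b -> `|w x| <= M) ->
  (forall x y, a <= x -> x <= y -> y <= b -> `|w y - w x| <= K * (y - x)) ->
  seq_abs_cont a b (w \* p).
Proof.
move=> ab M0 K0 pac pM wM wK e e0.
(* Adding 1 here, and to [M * K] below, avoids a zero denominator. *)
have e20 : 0 < e / 2 / (M + 1) by rewrite !divr_gt0// ltr_wpDl.
have [d d0 pd] := pac _ e20.
pose d' := e / 2 / (M * K + 1).
have d'0 : 0 < d' by rewrite !divr_gt0// ltr_wpDl// mulr_ge0.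
exists (Num.min d d'); first by rewrite lt_min d0.
move=> s ps; rewrite lt_min => /andP[sd sd'].
apply: (@le_trans _ _ (\sum_(q <- s) (M * `|p q.2 - p q.1| + M * K * (q.2 - q.1)))).
  rewrite big_seq [leRHS]big_seq; apply: ler_sum => q.
  move: ps => /andP[/allP ps _] /ps /and3P[/= aq q12 qb].
  have q1ab : a <= q.1 <= b by rewrite aq (le_trans q12 qb).
  have q2ab : a <= q.2 <= b by rewrite qb (le_trans aq q12).
  rewrite (_ : _ - _ = w q.2 * (p q.2 - p q.1) + p q.1 * (w q.2 - w q.1)); last by ring.
  apply: le_trans (ler_normD _ _) _; rewrite !normrM -mulrA; apply: lerD.
    by rewrite ler_wpM2r ?wM.
  by apply: ler_pM => //; [exact: pM|exact: wK].
rewrite big_split/= -!mulr_sumr (splitr e); apply: lerD.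
  apply: (@le_trans _ _ (M * (e / 2 / (M + 1)))); first by rewrite ler_wpM2l// pd.
  rewrite mulrA ler_pdivrMr ?ltr_wpDl// mulrC ler_wpM2l//; first by rewrite divr_ge0// ltW.
  by rewrite lerDl.
apply: (@le_trans _ _ (M * K * d')); first by rewrite ler_wpM2l ?mulr_ge0// ltW.
rewrite /d' mulrA ler_pdivrMr ?ltr_wpDl ?mulr_ge0// mulrC ler_wpM2l//.
  by rewrite divr_ge0// ltW.
by rewrite lerDl.
Qed.

(** A bounded derivative makes [w] Lipschitz on [[a, b]], so [w \* p] is absolutely continuous and
    its increment is the integral of its derivative, which the product rule gives almost
    everywhere. *)
Lemma seq_abs_cont_product_FTC a b p g w w' : a < b -> continuous p ->
  seq_abs_cont a b p -> measurable_fun setT g ->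
  {ae mu, forall x, a < x < b -> is_derive x 1 p (g x)} ->
  (forall x, is_derive x 1 w (w' x)) -> measurable_fun setT w' ->
  (exists K : R, forall x, a <= x <= b -> `|w' x| <= K) ->
  w b * p b - w a * p a = \int[mu]_(x in `]a, b]) (w' x * p x + w x * g x).
Proof.
move=> ab cp pac mg aeg dw mw' [K wK]; have lab := ltW ab.
have cw : continuous w.
  move=> x; apply: differentiable_continuous; apply/derivable1_diffP.
  by case: (dw x).
have bnd f : continuous f -> exists M : R, forall x, a <= x <= b -> `|f x| <= M.
  move=> cf; have cnf : {within `[a, b], continuous (fun x => `|f x|)}.
    apply: continuous_subspaceT => x; by apply: cvg_norm; exact: cf.
  have [c _ Hc] := EVT_max lab cnf; exists `|f c| => x xab.
  by apply: Hc; rewrite in_itv.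
have [M1 pM] := bnd _ cp; have [M2 wM] := bnd _ cw.
pose M : R := Num.max 0 (Num.max M1 M2); pose K' : R := Num.max 0 K.
have lip x y : a <= x -> x <= y -> y <= b -> `|w y - w x| <= K' * (y - x).
  move=> ax; rewrite le_eqVlt => /predU1P[<-|xy] yb; first by rewrite !subrr normr0 mulr0.
  have [|z] := MVT xy (fun x _ => dw x).
    by apply: continuous_subspaceT => z; exact: cw.
  rewrite in_itv/= => /andP[xz zy] ->.
  have yx0 : 0 <= y - x by rewrite subr_ge0 ltW.
  rewrite normrM (ger0_norm yx0) ler_wpM2r// le_max; apply/orP; right; apply: wK.
  by rewrite (le_trans ax (ltW xz)) (le_trans (ltW zy) yb).
have Fac : seq_abs_cont a b (w \* p).
  apply: (@seq_abs_contM a b p w M K') => //; rewrite ?le_max ?lexx//.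
    by move=> x xab; rewrite !le_max pM// orbT.
  by move=> x xab; rewrite !le_max wM// !orbT.
have [gF [intgF gFE aegF]] := seq_abs_cont_FTC ab Fac.
have := gFE a b (lexx a) lab (lexx b) => /= ->.
pose f x := w' x * p x + w x * g x.
have mf : measurable_fun setT f.
  apply: measurable_funD; apply: measurable_funM => //; apply: continuous_measurable_fun => //.
have mgF : measurable_fun setT gF by apply/measurable_EFinP; exact: measurable_int intgF.
rewrite /Rintegral; congr fine.
rewrite -integral_itv_bndo_bndc; last by apply: measurable_funTS; apply/measurable_EFinP.
rewrite -[RHS]integral_itv_bndo_bndc; last by apply: measurable_funTS; apply/measurable_EFinP.
apply: ae_eq_integral => //; [by apply: measurable_funTS; apply/measurable_EFinP..|].
have FF : Filter (almost_everywhere mu) by exact: (ae_filter_ringOfSetsType mu).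
apply: filterS2 aeg aegF => x dp dF; rewrite /= in_itv/= => xab.
congr EFin; have dp' := dp xab; have [_ <-] := dF xab.
have [_ ->] := is_deriveM (dw x) dp'.
by rewrite /GRing.scale/= addrC mulrC.
Qed.

Lemma van_trees_identity (U : set R) p g (l dl : R -> R) (e K x0 : R) :
  open U -> is_interval U -> U x0 -> continuous p -> (forall x, 0 <= p x) ->
  (forall x, ~ U x -> p x = 0) ->
  (forall a b, `[a, b]%classic `<=` U -> seq_abs_cont a b p) ->
  measurable_fun setT g -> (forall x, p x = 0 -> g x = 0) ->
  {ae mu, forall x, U x -> is_derive x 1 p (g x)} ->
  (forall x, is_derive x 1 l (dl x)) -> measurable_fun setT dl ->
  (forall x, 0 <= l x <= 1) -> (forall x, `|dl x| <= K) ->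
  mu.-integrable setT (fun x => (l x * p x)%:E) ->
  let f x := l x * p x + (x - e) * (dl x * p x + l x * g x) in
  mu.-integrable setT (fun x => (f x)%:E) -> \int[mu]_x f x = 0.
Proof.
move=> oU iU Ux0 cp p0 pU pac mg pg aeg dll mdl l01 dlK intlp f intf.
have cl : continuous l.
  move=> x; apply: differentiable_continuous; apply/derivable1_diffP.
  by case: (dll x).
pose w x := (x - e) * l x; pose w' x := l x + (x - e) * dl x.
have dxe x : is_derive x 1 (fun y : R => y - e) (1 : R).
  apply: (is_derive_ext (is_deriveB (is_derive_id x 1) (is_derive_cst e x 1))) => //.
  by rewrite subr0.
have dw x : is_derive x 1 w (w' x).
  apply: (is_derive_ext (is_deriveM (dxe x) (dll x))) => //.
  by rewrite /w' /GRing.scale/= mulr1 addrC.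
have cxe : continuous (fun x : R => x - e).
  by move=> x; apply: cvgB; [exact: cvg_id|exact: cvg_cst].
have cw : continuous w by move=> x; apply: cvgM; [exact: cxe|exact: cl].
have mw' : measurable_fun setT w'.
  apply: measurable_funD; first exact: continuous_measurable_fun.
  by apply: measurable_funM => //; exact: continuous_measurable_fun.
have ftc a b : a < b -> `[a, b]%classic `<=` U ->
    w b * p b - w a * p a = \int[mu]_(x in `]a, b]) f x.
  move=> ab abU; rewrite (@seq_abs_cont_product_FTC a b p g w w')//.
  - by apply: eq_Rintegral => x _; rewrite /f /w /w'; ring.
  - exact: pac.
  - apply: filterS aeg; first exact: (ae_filter_ringOfSetsType mu).
    move=> x H /andP[ax xb]; apply: H; apply: abU.
    by rewrite /= in_itv/= !ltW.
  - exists (1 + (`|a| + `|b| + `|e|) * K) => x /andP[ax xb].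
    apply: le_trans (ler_normD _ _) _; apply: lerD.
      by case/andP: (l01 x) => l0 l1; rewrite ger0_norm.
    rewrite normrM; apply: ler_pM => //.
    apply: le_trans (ler_normB _ _) _; rewrite lerD2r ler_norml.
    have := ler_norm b; have := ler_norm (- a); rewrite normrN.
    have := normr_ge0 a; have := normr_ge0 b.
    by move=> *; apply/andP; split; lra.
pose F x := w x * p x.
have cF : continuous F by move=> x; apply: cvgM; [exact: cw|exact: cp].
have F0 x : ~ U x -> F x = 0 by move=> /pU px; rewrite /F px mulr0.
(* Only [l * p] is integrable; the extra factor [x - e] still leaves points arbitrarily far out
   where [F] is small. *)
have small (r : bool) (eps X : R) : 0 < eps -> exists2 b, X <= (if r then b else - b) & `|F b| <= eps.
  move=> eps0; have [|b Xb Fb] := @integrable_end_small _ (fun x => l x * p x) e r _ intlp eps X eps0.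
    by move=> x; rewrite mulr_ge0//; case/andP: (l01 x).
  by exists b => //; rewrite /F /w -mulrA.
have [|b [Ub Fb bU]] := @right_end _ U F x0 oU iU Ux0 cF F0.
  by move=> eps X /(small true eps X)[b Xb Fb]; exists b.
(* The left end of [U] is treated as the right end of its reflection [V]. *)
pose V : set R := [set x | U (- x)].
have oV : open V by apply: open_comp oU => x _; exact: opp_continuous.
have iV : is_interval V.
  move=> x y Vx Vy z /andP[xz zy]; apply: (iU (- y) (- x)) => //.
  by rewrite !lerN2 xz zy.
have [||||a [Va Fa aV]] := @right_end _ V (F \o -%R) (- x0) oV iV.
- by rewrite /V/= opprK.
- move=> x; apply: (cvg_comp (-%R) F); [exact: opp_continuous|exact: cF].
- by move=> x Vx; exact: F0.
- move=> eps X /(small false eps X)[c Xc Fc]; exists (- c) => //=.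
  by rewrite opprK.
pose I k : set (measurableTypeR R) := `](- a k), (b k)]%classic.
have lim1 : \int[mu]_(x in I k) f x @[k --> \oo] --> \int[mu]_x f x.
  apply: cvg_Rintegral_sets => //.
    by move=> n; exact: measurable_itv.
  move=> x; have [Ux|nUx] := pselect (U x); last first.
    have fx : f x = 0 by rewrite /f (pU _ nUx) (pg _ (pU _ nUx)) !mulr0 addr0 mulr0 addr0.
    by apply: nearW => k; rewrite patchE fx; case: ifP.
  near=> k; rewrite patchE ifT// inE /I/= in_itv/=; apply/andP; split.
    rewrite ltrNl; near: k; apply: aV.
    by rewrite /V/= opprK.
  by apply: ltW; near: k; exact: bU.
have lim2 : \int[mu]_(x in I k) f x @[k --> \oo] --> (0 : R).
  have : F (b k) - (F \o -%R) (a k) @[k --> \oo] --> (0 - 0 : R) by exact: cvgB.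
  rewrite subrr; apply: cvg_trans; apply: near_eq_cvg; near=> k.
  rewrite /I -ftc//.
    apply: (@lt_trans _ _ x0).
      by rewrite ltrNl; near: k; apply: aV; rewrite /V/= opprK.
    by near: k; exact: bU.
  move=> x; rewrite /= in_itv/= => axb; apply: (iU (- a k) (b k)) => //.
  exact: Va.
by have := cvg_unique _ lim1 lim2; apply.
Unshelve. all: by end_near. Qed.

End VanTreesIdentity.

(** * Intervals, their interiors and their end points *)

Section RealTools.
Context {R : realType}.
Implicit Types (U Theta : set R) (f g p : R -> R) (x y a b : R).
Local Notation mu := (@lebesgue_measure R).

(** [right_end] for the zero function, so that only the approach to the ends remains, used on [U]
    and on its reflection. *)
Lemma open_itv_exhaust U x0 : open U -> is_interval U -> U x0 ->
  exists a b : nat -> R, (forall k, U (a k) /\ U (b k)) /\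
    forall x, U x -> \forall k \near \oo, a k < x < b k.
Proof.
move=> oU iU Ux0.
have inf0 (eps X : R) : 0 < eps -> exists2 b : R, X <= b & `|(cst 0 : R -> R) b| <= eps.
  by move=> e0; exists X => //=; rewrite normr0 ltW.
have [b [Ub _ bU]] := @right_end _ U (cst 0) x0 oU iU Ux0 (@cst_continuous _ _ _)
  (fun _ _ => erefl) inf0.
pose V : set R := [set x | U (- x)].
have oV : open V by apply: open_comp oU => x _; exact: opp_continuous.
have iV : is_interval V.
  move=> x y Vx Vy z /andP[xz zy]; apply: (iU (- y) (- x)) => //.
  by rewrite !lerN2 xz zy.
have Vx0 : V (- x0) by rewrite /V/= opprK.
have [a [Va _ aV]] := @right_end _ V (cst 0) (- x0) oV iV Vx0 (@cst_continuous _ _ _)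
  (fun _ _ => erefl) inf0.
exists (fun k => - a k), b; split=> [k|x Ux]; first by split; [exact: Va|exact: Ub].
near=> k; apply/andP; split; last by near: k; exact: bU.
by rewrite ltrNl; near: k; apply: aV; rewrite /V/= opprK.
Unshelve. all: by end_near. Qed.

Lemma is_interval_interior Theta : is_interval Theta -> is_interval Theta^°.
Proof.
move=> iT a b Ia Ib z /andP[]; rewrite le_eqVlt => /predU1P[<-//|az].
rewrite le_eqVlt => /predU1P[->//|zb].
apply: (filterS _ (near_in_itvoo (_ : z \in `]a, b[))).
  move=> t; rewrite /= in_itv/= => /andP[xt tz]; apply: (iT a b); try exact: interior_subset.
  by rewrite !ltW.
by rewrite in_itv/= az.
Qed.

Lemma is_interval_boundary Theta : is_interval Theta ->
  Theta `\` Theta^° `<=` [set inf Theta; sup Theta].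
Proof.
move=> iT y [Ty nTy].
have [[x Tx xy]|Hx] := pselect (exists2 x, Theta x & x < y); last first.
  left; apply/eqP; rewrite eq_le; apply/andP; split.
    apply: lb_le_inf; first by exists y.
    by move=> x Tx; rewrite leNgt; apply/negP => xy; apply: Hx; exists x.
  by apply: ge_inf => //; exists y => x Tx; rewrite leNgt; apply/negP => xy; apply: Hx; exists x.
have [[z Tz yz]|Hz] := pselect (exists2 z, Theta z & y < z); last first.
  right; apply/eqP; rewrite eq_le; apply/andP; split.
    by apply: ub_le_sup => //; exists y => z Tz; rewrite leNgt; apply/negP => yz; apply: Hz; exists z.
  apply: ge_sup; first by exists y.
  by move=> z Tz; rewrite leNgt; apply/negP => yz; apply: Hz; exists z.
exfalso; apply: nTy; apply: (filterS _ (near_in_itvoo (_ : y \in `]x, z[))).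
  move=> t; rewrite /= in_itv/= => /andP[xt tz]; apply: (iT x z) => //.
  by rewrite !ltW.
by rewrite in_itv/= xy.
Qed.

Lemma is_derive_min p x (d : R) : (forall y, p x <= p y) -> is_derive x 1 p d -> d = 0.
Proof.
move=> px [/cvg_ex[/= l pl] dE].
have {dE}-> : d = l by rewrite -dE; exact/cvg_lim.
apply/eqP; rewrite eq_le; apply/andP; split.
- have pl' := cvg_dnbhs_at_left pl; rewrite -(cvg_lim _ pl')//.
  apply: limr_le; first by apply/cvg_ex; exists l.
  near=> h; have h0 : h < 0 by near: h; exact: nbhs_left_lt.
  by rewrite /GRing.scale/= mulr_le0_ge0 ?subr_ge0// invr_le0 ltW.
- have pl' := cvg_dnbhs_at_right pl; rewrite -(cvg_lim _ pl')//.
  apply: limr_ge; first by apply/cvg_ex; exists l.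
  near=> h; have h0 : 0 < h by near: h; exact: nbhs_right_gt.
  by rewrite /GRing.scale/= mulr_ge0 ?subr_ge0// invr_ge0 ltW.
Unshelve. all: by end_near. Qed.

Lemma eq_seq_abs_cont a b f g : (forall x, a <= x <= b -> f x = g x) ->
  seq_abs_cont a b f -> seq_abs_cont a b g.
Proof.
move=> fg fac e e0; have [d d0 fd] := fac e e0; exists d => // s ps sd.
apply: le_trans (fd s ps sd); rewrite big_seq [leRHS]big_seq; apply: ler_sum => q.
move: ps => /andP[/allP ps _] /ps /and3P[/= aq q12 qb].
by rewrite !fg// ?aq ?qb ?(le_trans aq q12) ?(le_trans q12 qb).
Qed.

End RealTools.

(** * The extended prior density and its score *)

Section PriorDensity.
Context {R : realType} (Theta : set R).
Hypotheses (Theta_itv : is_interval Theta) (Theta_cl : closed Theta).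
Variables (prior : probability (measurableTypeR R) R) (dens : R -> R).
Hypotheses (dens_prior : is_density_on Theta prior dens)
  (dens_ac : locally_absolutely_continuous Theta dens)
  (dens_vanish : vanishes_at_endpoints Theta dens).
Implicit Types (x y a b : R).
Local Notation mu := (@lebesgue_measure R).
Local Notation U := (Theta^°).

(* Extending the density by 0 outside the interior makes it continuous on the
   whole line, thanks to dens_vanish. *)
Definition ext_dens : R -> R := dens \_ U.

Lemma ext_dens_in x : U x -> ext_dens x = dens x.
Proof. by move=> Ux; rewrite /ext_dens patchE ifT// inE. Qed.

Lemma ext_dens_out x : ~ U x -> ext_dens x = 0.
Proof. by move=> Ux; rewrite /ext_dens patchE ifF//; apply/negP; rewrite inE. Qed.

Lemma ext_dens_ge0 x : 0 <= ext_dens x.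
Proof.
have [Ux|nUx] := pselect (U x); last by rewrite ext_dens_out.
by rewrite ext_dens_in//; apply: (density_ge0 dens_prior); exact: interior_subset.
Qed.

Lemma ext_dens_abs_cont a b : `[a, b]%classic `<=` U -> seq_abs_cont a b ext_dens.
Proof.
move=> abU; apply: (@eq_seq_abs_cont _ a b dens); last first.
  exact/absolutely_continuous_seq/dens_ac.
by move=> x xab; rewrite ext_dens_in//; apply: abU; rewrite /= in_itv.
Qed.

(** Inside the interval, continuity comes from local absolute continuity; at an end point, from
    [dens_vanish]; elsewhere, from [Theta] being closed. *)
Lemma continuous_ext_dens : continuous ext_dens.
Proof.
move=> /= x; have [Ux|nUx] := pselect (U x).
  have [/= e e0 eU] : nbhs x U.
    by apply: open_nbhs_nbhs; split => //; exact: open_interior.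
  pose a := x - e / 2; pose b := x + e / 2.
  have e20 : 0 < e / 2 by rewrite divr_gt0.
  have ab : a <= b by rewrite /a /b; lra.
  have abU : `[a, b]%classic `<=` U.
    move=> y; rewrite /= in_itv/= /a /b => /andP[ay yb]; apply: eU.
    by rewrite /ball_/= ltr_norml; apply/andP; split; lra.
  have cc : continuous (ext_dens \o clamp a b).
    exact: seq_abs_cont_clamp ab (ext_dens_abs_cont abU).
  have ax : a <= x by rewrite /a; lra.
  have xb : x <= b by rewrite /b; lra.
  have {cc} := cc x; rewrite /continuous_at /= (clamp_id ax xb).
  apply: cvg_trans; apply: near_eq_cvg.
  have xab : x \in `]a, b[ by rewrite in_itv/= /a /b; apply/andP; split; lra.
  near=> y; rewrite /= clamp_id//.
    have : y \in `]a, b[ by near: y; exact: near_in_itvoo.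
    by rewrite in_itv/= => /andP[/ltW].
  have : y \in `]a, b[ by near: y; exact: near_in_itvoo.
  by rewrite in_itv/= => /andP[_ /ltW].
rewrite /continuous_at (ext_dens_out nUx).
have [Tx|nTx] := pselect (Theta x); last first.
  apply: (cvg_near_cst (0 : R)).
  have : nbhs x (~` Theta) by apply: open_nbhs_nbhs; split => //; exact: closed_openC.
  by apply: filterS => y nTy; rewrite ext_dens_out// => /interior_subset.
have /cvgrPdist_lt dv := dens_vanish (conj Tx nUx).
apply/cvgrPdist_lt => e e0.
have H0 : \forall y \near x, U y -> `|0 - dens y| < e by exact: dv.
near=> y; have H : U y -> `|0 - dens y| < e by near: y.
have [Uy|nUy] := pselect (U y); first by rewrite ext_dens_in//; exact: H.
by rewrite ext_dens_out// subr0 normr0.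
Unshelve. all: by end_near. Qed.

Lemma measurable_ext_dens : measurable_fun setT ext_dens.
Proof. exact: continuous_measurable_fun continuous_ext_dens. Qed.

Lemma measurable_interior : measurable (U : set (measurableTypeR R)).
Proof.
have oU : open U by exact: open_interior.
exact: open_measurable oU.
Qed.

Lemma boundary_null : mu (Theta `\` U) = 0%E.
Proof.
have fin : finite_set [set inf Theta; sup Theta] by exact: finite_set2.
have c0 : mu [set inf Theta; sup Theta] = 0%E.
  exact/countable_lebesgue_measure0/finite_set_countable.
apply/eqP; rewrite eq_le measure_ge0 andbT -c0 le_measure ?inE//.
- apply: measurableD; first exact: closed_measurable.
  exact: measurable_interior.
- exact: measurableU.
- exact: is_interval_boundary.
Qed.

Lemma prior_ext_dens (B : set (measurableTypeR R)) : measurable B ->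
  prior B = (\int[mu]_(x in B) (ext_dens x)%:E)%E.
Proof.
move=> mB; rewrite (densityE dens_prior mB).
have mU := measurable_interior.
have mT : measurable (Theta : set (measurableTypeR R)) by exact: closed_measurable.
have mdT : measurable_fun (B `&` Theta) (fun x => (dens x)%:E).
  apply/measurable_EFinP; apply: measurable_funS (density_measurable dens_prior) => //.
pose N : set (measurableTypeR R) := Theta `\` U.
rewrite (@ge0_negligible_integral _ _ _ mu (B `&` Theta) N)//; first last.
- exact: boundary_null.
- by move=> x [_ Tx]; rewrite lee_fin (density_ge0 dens_prior).
- exact: measurableI.
- exact: measurableD.
rewrite (_ : _ `\` _ = B `&` U); last first.
  apply/seteqP; split=> x /=.
    move=> [[Bx Tx] nTU]; split => //; apply: contrapT => nUx.
    by apply: nTU.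
  move=> [Bx Ux]; split; last by move=> [].
  by split => //; exact: interior_subset.
rewrite integral_mkcondr; apply: eq_integral => x _.
by rewrite /ext_dens !patchE; case: ifP.
Qed.

Lemma integral_ext_dens : (\int[mu]_x (ext_dens x)%:E = 1)%E.
Proof. by rewrite -prior_ext_dens// probability_setT. Qed.

Lemma integrable_ext_dens : mu.-integrable setT (EFin \o ext_dens).
Proof.
apply/integrableP; split; first by apply/measurable_EFinP; exact: measurable_ext_dens.
under eq_integral do rewrite /= ger0_norm ?ext_dens_ge0//.
by rewrite integral_ext_dens ltry.
Qed.

Lemma interior_nonempty : exists x0, U x0.
Proof.
apply: contrapT => noU; have := integral_ext_dens.
rewrite integral0_eq; last first.
  by move=> x _; rewrite ext_dens_out// => Ux; apply: noU; exists x.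
by move=> /eqP; rewrite eq_sym onee_eq0.
Qed.

(** Forcing [g] to be 0 where the density is 0 is consistent with its being the derivative, since
    such points are minima of the density. *)
Lemma ext_dens_score : exists g : R -> R, [/\ measurable_fun setT g,
  forall x, ext_dens x = 0 -> g x = 0 &
  {ae mu, forall x, U x -> is_derive x 1 ext_dens (g x)}].
Proof.
have [g0 mg0 g0E] := measurable_derivative continuous_ext_dens.
pose S : set R := [set x | 0 < ext_dens x].
have mS : measurable S.
  have -> : S = ext_dens @^-1` `]0, +oo[ by apply/seteqP; split=> x; rewrite /S/= in_itv/= andbT.
  by rewrite -[X in measurable X]setTI; apply: measurable_ext_dens.
exists (g0 \_ S); split.
- exact/(measurable_restrictT _ _).1/measurable_funTS.
- move=> x px; rewrite patchE ifF//; apply/negP; rewrite inE /S/= px ltxx//.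
- have [x0 Ux0] := interior_nonempty.
  have oU : open U by exact: open_interior.
  have iU : is_interval U by exact: is_interval_interior.
  have [a [b [abU abE]]] := open_itv_exhaust oU iU Ux0.
  (* Differentiability is known off a null set for each compact subinterval; countably many of these
     exhaust [U]. *)
  have ae k : {ae mu, forall x, a k < x < b k -> exists d, is_derive x 1 ext_dens d}.
    have [ab|ba] := ltP (a k) (b k); last first.
      by apply: aeW => x /andP[ax xb]; have := lt_trans ax xb; rewrite ltNge ba.
    have abk : `[a k, b k]%classic `<=` U.
      by move=> x; rewrite /= in_itv/= => xab; case: (abU k) => Ua Ub; exact: (iU (a k) (b k)).
    have [h [_ _ hE]] := seq_abs_cont_FTC ab (ext_dens_abs_cont abk).
    apply: filterS hE; first exact: (ae_filter_ringOfSetsType mu).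
    by move=> x H /H; exists (h x).
  have aeall : {ae mu, forall x k, a k < x < b k -> exists d, is_derive x 1 ext_dens d}.
    exact: ae_foralln.
  apply: filterS aeall; first exact: (ae_filter_ringOfSetsType mu).
  move=> x H Ux; have [k _ /(_ k (leqnn k))/H[d dx]] := abE x Ux.
  rewrite patchE; case: ifPn => [_|]; first by rewrite (g0E _ _ dx).
  move=> /negP; rewrite inE /S/= => /negP; rewrite -leNgt => px.
  have px0 : ext_dens x = 0 by apply/eqP; rewrite eq_le px ext_dens_ge0.
  apply: (is_derive_ext dx) => //; apply: (is_derive_min _ dx) => y.
  by rewrite px0; exact: ext_dens_ge0.
Qed.

(** Off a null set, and where the density is positive, the two integrands agree; at the other points
    the left one can be replaced by 0. An inequality in this direction is enough, and it holds
    without measurability of the right-hand integrand. *)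
Lemma fisher_location_ge (g : R -> R) : measurable_fun setT g ->
  (forall x, ext_dens x = 0 -> g x = 0) ->
  {ae mu, forall x, U x -> is_derive x 1 ext_dens (g x)} ->
  (\int[mu]_x (g x ^+ 2 / ext_dens x)%:E <= fisher_location prior dens)%E.
Proof.
move=> mg pg [N [mN N0 NE]]; set p := ext_dens.
have mp := measurable_ext_dens; rewrite -/p in mp.
pose phi x := (g x / p x) ^+ 2.
have mphi : measurable_fun setT phi.
  apply: measurable_funX; apply: measurable_funM => //.
  have -> : (fun x => (p x)^-1) = (fun x => p x `^ (-1)).
    by apply/funext => x; rewrite powR_inv1// ext_dens_ge0.
  by apply: (measurableT_comp (measurable_powR (-1))).
have -> : (\int[mu]_x (g x ^+ 2 / p x)%:E = \int[mu]_x ((phi x)%:E * (p x)%:E))%E.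
  apply: eq_integral => x _; rewrite -EFinM /phi; congr EFin.
  have [px|px] := eqVneq (p x) 0; first by rewrite px (pg _ px) !(expr2, mul0r, mulr0).
  by field.
rewrite -(@ge0_integral_density _ _ _ mu prior (EFin \o p) _ _ _ (EFin \o phi)); last 5 first.
- exact/measurable_EFinP.
- by move=> x; rewrite lee_fin ext_dens_ge0.
- exact: prior_ext_dens.
- by move=> x; rewrite lee_fin sqr_ge0.
- exact/measurable_EFinP.
have priorN : prior N = 0%E.
  rewrite prior_ext_dens//; apply: null_set_integral => //.
  by apply: measurable_funTS; apply/measurable_EFinP.
rewrite (ge0_negligible_integral mN)//; last 2 first.
- exact/measurable_EFinP.
- by move=> x _; rewrite lee_fin sqr_ge0.
rewrite integral_mkcond; apply: ge0_le_integral_nonmeas => x.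
  by rewrite patchE; case: ifP => // _; rewrite lee_fin sqr_ge0.
rewrite patchE; case: ifPn => [|_]; last by rewrite lee_fin sqr_ge0.
rewrite inE => -[_ nNx] /=; rewrite lee_fin /phi.
have [px|px] := eqVneq (p x) 0; first by rewrite px invr0 mulr0 expr2 mulr0 sqr_ge0.
have Ux : U x by apply: contrapT => /ext_dens_out; apply/eqP.
have dx : is_derive x 1 p (g x).
  by apply: contrapT => ndx; apply: nNx; apply: NE => /= H; apply: ndx; exact: H.
have p0 : 0 < p x by rewrite lt_neqAle eq_sym px ext_dens_ge0.
have dl : is_derive x 1 (fun u => ln (dens u)) (g x / p x).
  apply: (@near_eq_is_derive _ _ _ (fun u => ln (p u))).
    have : nbhs x U by apply: open_nbhs_nbhs; split => //; exact: open_interior.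
    by apply: filterS => y Uy; rewrite /p ext_dens_in.
  by apply: (is_derive_ext (is_derive1_comp (is_derive1_ln p0) dx)) => //; rewrite mulrC.
by rewrite derive1E; case: dl => _ ->.
Qed.

End PriorDensity.

(** * Van Trees' inequality for the transcript *)

Section VanTreesInequality.
Context {R : realType}.
Local Notation mu := (@lebesgue_measure R).

Lemma Rintegral_sum (I : eqType) (r : seq I) (F : I -> R -> R) :
  (forall i, i \in r -> mu.-integrable setT (EFin \o F i)) ->
  mu.-integrable setT (EFin \o (fun x => \sum_(i <- r) F i x)) /\
  \int[mu]_x (\sum_(i <- r) F i x) = \sum_(i <- r) \int[mu]_x F i x.
Proof.
elim: r => [_|i r ih intF].
  split; first by apply: eq_integrable (integrable0 _ _) => // x _; rewrite /= big_nil.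
  by under eq_Rintegral do rewrite big_nil; rewrite Rintegral_cst// mul0r big_nil.
have inti : mu.-integrable setT (EFin \o F i) by apply: intF; exact: mem_head.
have [|intr {}ih] := ih.
  by move=> j jr; apply: intF; rewrite inE jr orbT.
split.
  apply: eq_integrable (integrableD measurableT inti intr) => // x _ /=.
  by rewrite big_cons.
under eq_Rintegral do rewrite big_cons.
by rewrite RintegralD// ih big_cons.
Qed.

(* The right-hand side is p l (y + lam T / (p l))^2. *)
Lemma score_square_ge0 (p l T y lam : R) : 0 <= p -> 0 <= l ->
  (p * l = 0 -> T = 0) ->
  0 <= y ^+ 2 * (l * p) + 2 * lam * (y * T) + lam ^+ 2 * (T ^+ 2 / (p * l)).
Proof.
move=> p0 l0 T0; have [pl|pl] := eqVneq (p * l) 0.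
  by rewrite (T0 pl) (mulrC l) pl !(mulr0, mul0r, expr2, addr0).
have -> : y ^+ 2 * (l * p) + 2 * lam * (y * T) + lam ^+ 2 * (T ^+ 2 / (p * l)) =
    p * l * (y + lam * T / (p * l)) ^+ 2.
  by move: pl; rewrite mulf_eq0 negb_or => /andP[pn ln]; field; rewrite pn ln.
by rewrite mulr_ge0 ?sqr_ge0// mulr_ge0.
Qed.

Variables (s : R) (Theta : set R).
Hypotheses (s_gt0 : 0 < s).
Variable S : seq bool -> set (measurableTypeR R).
Hypothesis mS : forall h, measurable (S h).
Hypotheses (Theta_itv : is_interval Theta) (Theta_cl : closed Theta).
Variables (prior : probability (measurableTypeR R) R) (dens : R -> R).
Hypotheses (dens_prior : is_density_on Theta prior dens)
  (dens_ac : locally_absolutely_continuous Theta dens)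
  (dens_vanish : vanishes_at_endpoints Theta dens).
Variables (n : nat) (est : seq bool -> R).
Hypothesis n_gt0 : (0 < n)%N.

Local Notation p := (ext_dens Theta dens).
Local Notation l m := (lik s S [::] m).
Local Notation dl m := (dlik s S [::] m).
Local Notation I0 := (fisher_location prior dens).

Lemma van_trees_real (g : R -> R) : measurable_fun setT g ->
  (forall x, p x = 0 -> g x = 0) ->
  {ae mu, forall x, Theta^° x -> is_derive x 1 p (g x)} ->
  mu.-integrable setT (EFin \o (fun x => g x ^+ 2 / p x)) ->
  (forall m, m \in bits n -> mu.-integrable setT
     (EFin \o (fun x => (x - est m) ^+ 2 * (l m x * p x)))) ->
  (\int[mu]_x (g x ^+ 2 / p x) + n%:R * one_bit_info s)^-1 <=
  \sum_(m <- bits n) \int[mu]_x ((x - est m) ^+ 2 * (l m x * p x)).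
Proof.
move=> mg pg aeg intB intA.
have p0 x : 0 <= p x := ext_dens_ge0 dens_prior x.
have cp : continuous p := continuous_ext_dens Theta_cl dens_ac dens_vanish.
have mp : measurable_fun setT p by exact: continuous_measurable_fun.
have intp : mu.-integrable setT (EFin \o p).
  exact: (integrable_ext_dens Theta_itv Theta_cl dens_prior dens_ac dens_vanish).
have p1 : \int[mu]_x p x = 1.
  by rewrite /Rintegral (integral_ext_dens Theta_itv Theta_cl dens_prior).
pose K := n%:R * one_bit_info s.
have K0 : 0 < K by rewrite mulr_gt0 ?ltr0n// one_bit_info_gt0.
have l0 m x : 0 <= l m x by exact: lik_ge0.
have l1 m x : l m x <= 1 by exact: lik_le1.
have dll m (x : R) : is_derive x 1 (l m) (dl m x) by exact: is_derive_lik.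
have cl m : continuous (l m).
  move=> x; apply: differentiable_continuous; apply/derivable1_diffP.
  by case: (dll m x).
have ml m : measurable_fun setT (l m) by exact: continuous_measurable_fun.
have mdl m : measurable_fun setT (dl m).
  have [h mh hE] := measurable_derivative (cl m).
  by rewrite (_ : dl m = h)//; apply/funext => x; rewrite (hE _ _ (dll m x)).
pose T (m : seq bool) (x : R) : R := dl m x * p x + l m x * g x.
pose A (m : seq bool) (x : R) : R := (x - est m) ^+ 2 * (l m x * p x).
pose Q (m : seq bool) (x : R) : R := T m x ^+ 2 / (p x * l m x).
pose B (x : R) : R := g x ^+ 2 / p x.
pose f (m : seq bool) (x : R) : R := l m x * p x + (x - est m) * T m x.
have T0 m x : p x * l m x = 0 -> T m x = 0.
  rewrite /T => /eqP; rewrite mulf_eq0 => /orP[]/eqP z; first by rewrite z (pg _ z) !mulr0 addr0.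
  by rewrite z (dlik_eq0 s_gt0 mS z) !mul0r addr0.
have Q0 m x : 0 <= Q m x by rewrite divr_ge0 ?sqr_ge0// mulr_ge0.
have QE m x : Q m x = B x * l m x + 2 * g x * dl m x + p x * (dl m x ^+ 2 / l m x).
  rewrite /Q /T /B; have := pg x; have := @dlik_eq0 _ _ s_gt0 _ mS [::] m x.
  move: (g x) (p x) (l m x) (dl m x) => g' p' l' k.
  have [-> /(_ erefl)-> _|ln _] := eqVneq l' 0; first by rewrite !(mulr0, mul0r, invr0, expr2, addr0).
  have [-> /(_ erefl)->|pn _] := eqVneq p' 0; first by rewrite !(mulr0, mul0r, invr0, expr2, addr0).
  by field; rewrite pn ln.
(* The joint information of parameter and transcript is that of the prior plus that of the messages:
   the cross terms cancel because the [dl m x] sum to 0. *)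
have sumQ x : \sum_(m <- bits n) Q m x <= B x + K * p x.
  under eq_bigr do rewrite QE.
  rewrite !big_split/= -!mulr_sumr (sum_lik s mS) (sum_dlik s_gt0 mS) mulr1 mulr0 addr0.
  by rewrite lerD2l mulrC ler_wpM2r// (sum_info s_gt0 mS).
have Qle m x : m \in bits n -> Q m x <= B x + K * p x.
  move=> mn; apply: le_trans (sumQ x); rewrite (big_rem m mn)/= lerDl.
  by rewrite sumr_ge0.
have intKp k : mu.-integrable setT (EFin \o (fun x => k * p x)).
  by have := integrableZl measurableT k intp; exact: eq_integrable.
have intBK : mu.-integrable setT (EFin \o (fun x => B x + K * p x)).
  by have := integrableD measurableT intB (intKp K); exact: eq_integrable.
have mlp m : measurable_fun setT (fun x => l m x * p x) by exact: measurable_funM.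
have mfm m : measurable_fun setT (f m).
  apply: measurable_funD; first exact: mlp.
  apply: measurable_funM; first exact: measurable_funB.
  by apply: measurable_funD; exact: measurable_funM.
have intlp m : mu.-integrable setT (fun x => (l m x * p x)%:E).
  apply: (le_integrable measurableT _ _ intp).
    by apply/measurable_EFinP; exact: mlp.
  move=> x _; rewrite lee_fin !ger0_norm ?mulr_ge0//.
  by rewrite -[leRHS]mul1r ler_wpM2r.
have intf m : m \in bits n -> mu.-integrable setT (fun x => (f m x)%:E).
  move=> mn; have intD : mu.-integrable setT (EFin \o (fun x => p x + (A m x + (B x + K * p x)))).
    have := integrableD measurableT intp (integrableD measurableT (intA m mn) intBK).
    exact: eq_integrable.
  apply: (le_integrable measurableT _ _ intD).
    by apply/measurable_EFinP; exact: mfm.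
  move=> x _; rewrite lee_fin.
  have A0 : 0 <= A m x by rewrite mulr_ge0 ?sqr_ge0// mulr_ge0.
  (* The squares with weights 1 and -1 give [2 |(x - est m) T| <= A + Q], so [f] is dominated. *)
  have := score_square_ge0 (x - est m) 1 (p0 x) (l0 m x) (@T0 m x).
  have := score_square_ge0 (x - est m) (-1) (p0 x) (l0 m x) (@T0 m x).
  rewrite -/(A m x) -/(Q m x) sqrrN expr1n !mul1r; have := Qle _ x mn; have := Q0 m x.
  have lp : l m x * p x <= p x by rewrite -[leRHS]mul1r ler_wpM2r.
  have lp0 : 0 <= l m x * p x by rewrite mulr_ge0.
  move=> q0 qb h1 h2; rewrite /f [leRHS]ger0_norm; last first.
    by rewrite addr_ge0// addr_ge0// (le_trans q0 qb).
  move: ((x - est m) * T m x) (l m x * p x) (A m x) (Q m x) (B x + K * p x) lp lp0 A0 q0 qb h1 h2.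
  by move=> y w a q b wp w0 a0 q0 qb h1 h2; rewrite ler_norml; apply/andP; split; lra.
have f0 m : m \in bits n -> \int[mu]_x f m x = 0.
  move=> mn; have [x0 Ux0] := interior_nonempty Theta_itv Theta_cl dens_prior.
  apply: (@van_trees_identity _ Theta^° p g (l m) (dl m) (est m) (1 + K) x0) => //.
  - exact: open_interior.
  - exact: is_interval_interior.
  - exact: ext_dens_out.
  - by move=> a b abU; exact: (ext_dens_abs_cont dens_ac abU).
  - by move=> x; rewrite l0 l1.
  (* [2 |k| <= 1 + k^2] turns the bound on the square into one on [|dl m x|]. *)
  - move=> x; have := dlik_sqr_le s_gt0 mS [::] x mn; rewrite -/K => dK.
    have := sqr_ge0 (`|dl m x| - 1); rewrite sqrrB1 real_normK ?num_real//.
    by have := normr_ge0 (dl m x); lra.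
  - exact: intf.
set J := \int[mu]_x (g x ^+ 2 / p x); set M := \sum_(m <- _) _.
have J0 : 0 <= J by apply: Rintegral_ge0 => x _; rewrite divr_ge0 ?sqr_ge0.
have JK : 0 < J + K by rewrite ltr_wpDl.
(* The minimiser of [lam ^+ 2 * (J + K) - 2 * lam], the integral of [C] below. *)
pose lam : R := (J + K)^-1.
have intF m : m \in bits n ->
    mu.-integrable setT (EFin \o (fun x => A m x + 2 * lam * f m x)).
  move=> mn; have := integrableZl measurableT (2 * lam) (intf m mn).
  by move=> /(integrableD measurableT (intA m mn)); exact: eq_integrable.
have FE m : m \in bits n -> \int[mu]_x (A m x + 2 * lam * f m x) = \int[mu]_x A m x.
  move=> mn; rewrite RintegralD//; [|exact: intA|].
    by rewrite RintegralZl ?f0 ?mulr0 ?addr0//; exact: intf.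
  by have := integrableZl measurableT (2 * lam) (intf m mn); exact: eq_integrable.
have [intS SE] := Rintegral_sum intF.
(* The term [- 2 * lam * p x] cancels the contribution of [l m x * p x] in [f], the likelihoods
   summing to 1. What remains dominates the sum of the completed squares. *)
pose C (x : R) : R := lam ^+ 2 * (B x + K * p x) - 2 * lam * p x.
have intC1 : mu.-integrable setT (EFin \o (fun x => lam ^+ 2 * (B x + K * p x))).
  by have := integrableZl measurableT (lam ^+ 2) intBK; exact: eq_integrable.
have intC : mu.-integrable setT (EFin \o C).
  by have := integrableB measurableT intC1 (intKp (2 * lam)); exact: eq_integrable.
have CE : \int[mu]_x C x = lam ^+ 2 * (J + K) - 2 * lam.
  have kp k : \int[mu]_x (k * p x) = k by rewrite RintegralZl// p1 mulr1.
  have BK : \int[mu]_x (B x + K * p x) = J + K by rewrite RintegralD// kp.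
  by rewrite /C RintegralB// kp RintegralZl// BK.
have : 0 <= \int[mu]_x (\sum_(m <- bits n) (A m x + 2 * lam * f m x) + C x).
  apply: Rintegral_ge0 => x _.
  have : 0 <= \sum_(m <- bits n) (A m x + 2 * lam * ((x - est m) * T m x) + lam ^+ 2 * Q m x).
    by apply: sumr_ge0 => m _; apply: score_square_ge0 => //; exact: T0.
  have -> : \sum_(m <- bits n) (A m x + 2 * lam * f m x) =
      \sum_(m <- bits n) (A m x + 2 * lam * ((x - est m) * T m x)) + 2 * lam * p x.
    transitivity (\sum_(m <- bits n) ((A m x + 2 * lam * ((x - est m) * T m x)) + 2 * lam * p x * l m x)).
      by apply: eq_bigr => m _; rewrite /f; ring.
    by rewrite big_split/= -mulr_sumr (sum_lik s mS) mulr1.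
  rewrite big_split/= -mulr_sumr /C => h.
  have : lam ^+ 2 * \sum_(m <- bits n) Q m x <= lam ^+ 2 * (B x + K * p x).
    by rewrite ler_wpM2l ?sqr_ge0.
  by move: h; lra.
rewrite RintegralD// SE CE (_ : \sum_(m <- _) _ = M); last first.
  by rewrite /M big_seq [RHS]big_seq; apply: eq_bigr => m mn; exact: FE.
have -> : lam ^+ 2 * (J + K) = lam by rewrite /lam; field; rewrite gt_eqF.
by rewrite -/K -/lam; lra.
Qed.

Lemma van_trees_ereal : (I0 < +oo)%E ->
  (((fine I0 + n%:R * one_bit_info s)^-1)%:E <=
  \sum_(m <- bits n) \int[mu]_x ((x - est m) ^+ 2 * (l m x * p x))%:E)%E.
Proof.
move=> I0oo.
have p0 x : 0 <= p x := ext_dens_ge0 dens_prior x.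
have mp : measurable_fun setT p by exact: measurable_ext_dens.
have [g [mg pg aeg]] := ext_dens_score Theta_itv Theta_cl dens_prior dens_ac dens_vanish.
have gI0 := fisher_location_ge Theta_itv Theta_cl dens_prior dens_ac dens_vanish mg pg aeg.
have K0 : 0 < n%:R * one_bit_info s by rewrite mulr_gt0 ?ltr0n// one_bit_info_gt0.
have A0 m x : 0 <= (x - est m) ^+ 2 * (l m x * p x).
  by rewrite mulr_ge0 ?sqr_ge0// mulr_ge0// lik_ge0.
(* An infinite risk makes the claim trivial; a finite one makes every summand integrable, as
   [van_trees_real] demands. *)
have [Soo|Sfin] := eqVneq (\sum_(m <- bits n)
    \int[mu]_x ((x - est m) ^+ 2 * (l m x * p x))%:E)%E +oo%E.
  by rewrite Soo leey.
have mA m : measurable_fun setT (fun x : R => (x - est m) ^+ 2 * (l m x * p x)).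
  apply: measurable_funM; first by apply: measurable_funX; exact: measurable_funB.
  apply: measurable_funM => //; apply: continuous_measurable_fun => x.
  apply: differentiable_continuous; apply/derivable1_diffP.
  by case: (is_derive_lik s_gt0 mS [::] m x).
have intA m : m \in bits n -> mu.-integrable setT
    (EFin \o (fun x => (x - est m) ^+ 2 * (l m x * p x))).
  move=> mn; apply/integrableP; split; first by apply/measurable_EFinP; exact: mA.
  under eq_integral do rewrite /= ger0_norm ?A0//.
  apply: (@le_lt_trans _ _ (\sum_(m <- bits n)
    \int[mu]_x ((x - est m) ^+ 2 * (l m x * p x))%:E)%E); last by rewrite ltey.
  rewrite (big_rem m mn)/= leeDl//.
  by apply: sume_ge0 => k _; apply: integral_ge0 => x _; rewrite lee_fin.
have B0 x : 0 <= g x ^+ 2 / p x by rewrite divr_ge0 ?sqr_ge0.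
have mB : measurable_fun setT (fun x => g x ^+ 2 / p x).
  apply: measurable_funM; first exact: measurable_funX.
  have -> : (fun x => (p x)^-1) = (fun x => p x `^ (-1)).
    by apply/funext => x; rewrite powR_inv1.
  by apply: (measurableT_comp (measurable_powR (-1))).
have intB : mu.-integrable setT (EFin \o (fun x => g x ^+ 2 / p x)).
  apply/integrableP; split; first by apply/measurable_EFinP; exact: mB.
  under eq_integral do rewrite /= ger0_norm ?B0//.
  exact: le_lt_trans gI0 I0oo.
have main := van_trees_real mg pg aeg intB intA.
have AE m : m \in bits n -> (\int[mu]_x ((x - est m) ^+ 2 * (l m x * p x))%:E)%E =
    (\int[mu]_x ((x - est m) ^+ 2 * (l m x * p x)))%:E.
  by move=> mn; rewrite /Rintegral fineK//; exact: integrable_fin_num (intA m mn).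
rewrite big_seq (eq_bigr _ AE) -big_seq sumEFin lee_fin.
apply: le_trans main.
set J := \int[mu]_x _.
have J0 : 0 <= J by apply: Rintegral_ge0 => x _.
have JI : J <= fine I0.
  rewrite /J /Rintegral; apply: fine_le => //.
    exact: integrable_fin_num intB.
  by rewrite ge0_fin_numE// (le_trans _ gI0)// integral_ge0// => x _; rewrite lee_fin.
rewrite lef_pV2 ?posrE; [by rewrite lerD2r| |].
  by rewrite ltr_wpDl// (le_trans J0).
by rewrite ltr_wpDl.
Qed.

End VanTreesInequality.

(** * Joint law of the parameter and the transcript *)

Section JointLaw.
Context {R : realType} {d : measure_display} {T : measurableType d}.
Variables (P : probability T R) (n : nat) (sigma : R).
Hypothesis sigma_gt0 : 0 < sigma.
Variables (prior : probability (measurableTypeR R) R).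
Variables (theta : {RV P >-> R}) (X : 'I_n -> {RV P >-> R}) (M : 'I_n -> T -> bool).
Hypothesis one_bit : adaptive_one_bit prior sigma theta X M.
Implicit Types (h m : seq bool) (w : T).

Definition transcript w : n.-tuple bool := [tuple M i w | i < n].

Lemma take_transcript (i : 'I_n) w :
  take i (transcript w) = [tuple M (widen_ord (ltnW (ltn_ord i)) j) w | j < i].
Proof.
apply: (@eq_from_nth _ false); first by rewrite size_take !size_tuple ltn_ord.
move=> j; rewrite size_take size_tuple ltn_ord => ji.
rewrite nth_take//; have jn : (j < n)%N by exact: ltn_trans ji (ltn_ord i).
rewrite -(tnth_nth false (transcript w) (Ordinal jn)) tnth_mktuple.
rewrite -(tnth_nth false [tuple M (widen_ord (ltnW (ltn_ord i)) j) w | j < i] (Ordinal ji)).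
by rewrite tnth_mktuple; congr (M _ w); exact: val_inj.
Qed.

(** The encoders, typed by the length of their history, merge into a single family because that
    length determines which message is being sent; a history too long for any encoder gets the empty
    set. *)
Lemma encoder_sets : exists2 S : seq bool -> set (measurableTypeR R),
  (forall h, measurable (S h)) &
  forall (i : 'I_n) w, S (take i (transcript w)) (X i w) <-> M i w.
Proof.
have Hm := messages_adaptive one_bit.
pose enc (i : 'I_n) : i.-tuple bool -> R -> bool := s2val (cid2 (Hm i)).
have menc i t : measurable_fun setT (enc i t) := s2valP (cid2 (Hm i)) t.
have encE i w : M i w = enc i [tuple M (widen_ord (ltnW (ltn_ord i)) j) w | j < i] (X i w).
  exact: s2valP' (cid2 (Hm i)) w.
pose S h : set (measurableTypeR R) :=
  [set x | exists (i : 'I_n) (t : i.-tuple bool), tval t = h /\ enc i t x].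
have SE (i : 'I_n) (t : i.-tuple bool) x : S t x <-> enc i t x.
  split=> [[j [u [ut jux]]]|itx]; last by exists i, t.
  have ji : j = i by apply: val_inj; rewrite /= -(size_tuple u) -(size_tuple t) ut.
  by subst j; rewrite (val_inj ut) in jux.
exists S => [h|i w]; last first.
  by rewrite take_transcript encE; exact: SE.
have [[i [t th]]|no] := pselect (exists (i : 'I_n) (t : i.-tuple bool), tval t = h).
  have -> : S h = enc i t @^-1` [set true].
    by rewrite -th; apply/seteqP; split=> x /=; [move/SE|move=> itx; apply/SE].
  by rewrite -[X in measurable X]setTI; exact: menc.
have -> : S h = set0.
  by apply/seteqP; split=> x //= [i [t [th _]]]; apply: no; exists i, t.
exact: measurable0.
Qed.

Variable S : seq bool -> set (measurableTypeR R).
Hypothesis mS : forall h, measurable (S h).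
Hypothesis MS : forall (i : 'I_n) w, S (take i (transcript w)) (X i w) <-> M i w.

Lemma cellP h b x : cell S h b x <-> (S h x <-> b).
Proof.
case: b => /=; first by split=> [?|->].
by split=> [nS|nS /nS].
Qed.

(** With the whole transcript prescribed, every acceptance set is determined by a prefix of [m], so
    the adaptive event becomes a rectangle to which [cond_iid_normal] applies. *)
Lemma transcript_event m : size m = n ->
  [set w | tval (transcript w) = m] =
  \bigcap_(i in [set: 'I_n]) (X i @^-1` cell S (take i m) (nth false m i)).
Proof.
move=> mn.
have nthM (i : 'I_n) w : nth false (transcript w) i = M i w.
  by rewrite -(tnth_nth false (transcript w) i) tnth_mktuple.
apply/seteqP; split=> [w tm i _|w H].
  have <- : tval (transcript w) = m := tm.
  by apply/cellP; rewrite nthM; exact: MS.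
apply: (@eq_from_nth _ false (transcript w) m); first by rewrite size_tuple.
move=> j; rewrite size_tuple => jn.
(* Strong induction: only agreement of all earlier messages with [m] identifies the acceptance set
   in force at step [j]. *)
have [k] := ubnP j; elim: k j jn => // k ih j jn; rewrite ltnS => jk.
have tk : take j (transcript w) = take j m.
  apply: (@eq_from_nth _ false); first by rewrite !size_take size_tuple mn.
  move=> i; rewrite size_take size_tuple jn => ij.
  by rewrite !nth_take//; apply: ih; [exact: ltn_trans ij jn|exact: leq_trans ij jk].
have := H (Ordinal jn) I => /cellP /=; rewrite -tk => Sm.
have := MS (Ordinal jn) w; rewrite -nthM /= => Sw.
by apply/idP/idP => [/Sw/Sm|/Sm/Sw].
Qed.

Lemma prod_cell h m t :
  (\prod_(i < size m) normal_prob t sigma (cell S (h ++ take i m) (nth false m i)) =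
  (lik sigma S h m t)%:E)%E.
Proof.
elim: m h => [|b m ih] h; first by rewrite big_ord0.
rewrite big_ord_recl/= ?take0 cats0 normal_massE; last exact: measurable_cell.
rewrite EFinM.
congr (_ * _)%E; rewrite -ih; apply: eq_bigr => i _.
by rewrite /bump/= cat_rcons.
Qed.

Local Notation l m := (lik sigma S [::] m).

Lemma measurable_lik m : measurable_fun setT (l m).
Proof.
apply: continuous_measurable_fun => x.
apply: differentiable_continuous; apply/derivable1_diffP.
by case: (is_derive_lik sigma_gt0 mS [::] m x).
Qed.

Lemma integral_distribution_prior (B : set R) (f : R -> \bar R) :
  measurable B -> measurable_fun B f -> (forall x, 0 <= f x)%E ->
  (\int[distribution P theta]_(t in B) f t = \int[prior]_(t in B) f t)%E.
Proof.
move=> mB mf f0.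
have mid : measurable_fun setT (idfun : measurableTypeR R -> R) by exact: measurable_id.
rewrite (eq_measure_integral (pushforward prior (idfun : measurableTypeR R -> R))); last first.
  by move=> A mA _; exact: (theta_prior one_bit mA).
by rewrite (ge0_integral_pushforward mid)// => x _; exact: f0.
Qed.

Lemma joint_law (B : set R) m : measurable B -> size m = n ->
  P (theta @^-1` B `&` [set w | tval (transcript w) = m]) =
  (\int[prior]_(t in B) (l m t)%:E)%E.
Proof.
move=> mB mn; rewrite transcript_event//.
have := samples_normal one_bit mB (fun i : 'I_n => measurable_cell mS (take i m) (nth false m i)).
move=> ->; rewrite -integral_distribution_prior//; first last.
- by move=> x; rewrite lee_fin lik_ge0.
- by apply: measurable_funTS; apply/measurable_EFinP; exact: measurable_lik.
apply: eq_integral => t _; rewrite -prod_cell.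
by move: (mn) => <-.
Qed.

Lemma measurable_transcript m : size m = n ->
  measurable [set w | tval (transcript w) = m].
Proof.
move=> mn; rewrite transcript_event//.
apply: fin_bigcap_measurable => // i _.
rewrite -[X in measurable X]setTI.
exact: (measurable_funPT (X i)) _ _ (measurable_cell mS _ _).
Qed.

(** By [joint_law], the image under [theta] of [P] restricted to the event has density [l m] with
    respect to [prior]. *)
Lemma integral_transcript m (f : R -> R) : size m = n ->
  measurable_fun setT f -> (forall x, 0 <= f x) ->
  (\int[P]_w ((f (theta w))%:E * (\1_[set w | tval (transcript w) = m] w)%:E) =
   \int[prior]_t ((f t)%:E * (l m t)%:E))%E.
Proof.
move=> mn mf f0; set E := [set w | _].
have mE : measurable E by exact: measurable_transcript.
have Eoo : (P E < +oo)%E by rewrite (le_lt_trans (probability_le1 _ mE)) ?ltry.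
pose nu : {finite_measure set T -> \bar R} := mfrestr mE Eoo.
pose th : T -> measurableTypeR R := theta.
have mth : measurable_fun setT th by exact: (measurable_funPT theta).
rewrite -(@ge0_integral_density _ _ _ P nu); last 5 first.
- by apply/measurable_EFinP; exact: measurable_indic.
- by move=> w; rewrite lee_fin.
- by move=> B mB; rewrite integral_indic// setIC.
- by move=> w; rewrite lee_fin.
- by apply/measurable_EFinP; exact: measurableT_comp.
pose thM : {mfun T >-> measurableTypeR R} := HB.pack th
  (isMeasurableFun.Build _ _ T (measurableTypeR R) th mth).
have fin : fin_num_fun (pushforward nu thM).
  move=> B mB; rewrite /pushforward; apply: fin_num_measure.
  by rewrite -[X in measurable X]setTI; exact: (mth measurableT _ mB).
pose nu1 := HB.pack (pushforward nu thM)
  (Measure_isFinite.Build _ (measurableTypeR R) R (pushforward nu thM) fin)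
  : {finite_measure set (measurableTypeR R) -> \bar R}.
pose nu' : {finite_measure set (measurableTypeR R) -> \bar R} := nu1 mth mth mth mth.
have ml := measurable_lik m.
rewrite -(@ge0_integral_density _ _ _ prior nu' (EFin \o l m) _ _ _ (EFin \o f)); last 5 first.
- by apply/measurable_EFinP; exact: ml.
- by move=> t; rewrite lee_fin lik_ge0.
- by move=> B mB; rewrite -joint_law.
- by move=> t; rewrite lee_fin.
- by apply/measurable_EFinP; exact: mf.
rewrite [RHS](@ge0_integral_pushforward _ _ _ _ _ th mth nu setT)//.
- by apply/measurable_EFinP; exact: mf.
- by move=> t _; rewrite lee_fin.
Qed.

Lemma mean_squared_errorE (est : n.-tuple bool -> R) :
  mean_squared_error theta M est = (\sum_(m <- bits n)
    \int[prior]_t (((t - est (insubd (nseq_tuple n false) m)) ^+ 2)%:E * (l m t)%:E))%E.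
Proof.
(* The default [nseq_tuple n false] is harmless: every word in [bits n] has length [n]. *)
set e := fun m : seq bool => est (insubd (nseq_tuple n false) m).
have me m : measurable_fun setT (fun x : R => (x - e m) ^+ 2).
  by apply: measurable_funX; exact: measurable_funB.
have mE m : measurable [set w | tval (transcript w) = m].
  have [mn|mn] := eqVneq (size m) n; first exact: measurable_transcript.
  rewrite (_ : [set w | _] = set0)//.
  by apply/seteqP; split=> w // wm; case/eqP: mn; rewrite -[m]wm size_tuple.
rewrite /mean_squared_error unlock.
transitivity (\int[P]_w \sum_(m <- bits n) (((theta w - e m) ^+ 2)%:E *
    (\1_[set w | tval (transcript w) = m] w)%:E))%E.
  apply: eq_integral => w _.
  rewrite (bigD1_seq (tval (transcript w))) ?uniq_bits//; last first.
    by rewrite mem_bits size_tuple.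
  rewrite big1; last first.
    move=> m mw; rewrite indicE memNset ?mule0// => wm.
    by case/eqP: mw; exact/esym.
  by rewrite [RHS]addr0 indicE mem_set// mule1 /e valKd.
rewrite ge0_integral_sum//.
- rewrite big_seq [RHS]big_seq; apply: eq_bigr => m; rewrite mem_bits => /eqP mn.
  by rewrite (integral_transcript mn (me m))// => x; exact: sqr_ge0.
- move=> m; apply: emeasurable_funM; apply/measurable_EFinP.
    by apply: (measurableT_comp (me m)); exact: (measurable_funPT theta).
  exact: measurable_indic.
- by move=> m w _; rewrite mule_ge0// lee_fin ?sqr_ge0.
Qed.

End JointLaw.

(** * Evaluation of the bound, its asymptotics, and the conclusion *)

Lemma one_bit_boundE (R : realType) (sigma r : R) (n : nat) :
  0 < sigma -> 0 <= r -> (0 < n)%N ->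
  one_bit_bound sigma r%:E n =
  (pi * sigma ^+ 2 / (2 * n%:R + pi * sigma ^+ 2 * r))%:E.
Proof.
move=> s0 r0 n0; rewrite /one_bit_bound -EFinM -EFinD inver ifF -?EFinM//.
apply/negbTE; rewrite gt_eqF// ltr_pwDl// ?mulr_gt0 ?ltr0n//.
by rewrite !mulr_ge0 ?pi_ge0 ?exprn_ge0// ltW.
Qed.

Lemma one_bit_bound_pinfty (R : realType) (sigma : R) (n : nat) :
  0 < sigma -> one_bit_bound sigma +oo n = 0%E.
Proof.
move=> s0; rewrite /one_bit_bound gt0_muley; last first.
  by rewrite lte_fin mulr_gt0 ?pi_gt0 ?exprn_gt0.
by rewrite addey// invey mule0.
Qed.

Lemma one_bit_bound_info (R : realType) (sigma r : R) (n : nat) :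
  0 < sigma -> 0 <= r -> (0 < n)%N ->
  one_bit_bound sigma r%:E n = ((r + n%:R * one_bit_info sigma)^-1)%:E.
Proof.
move=> s0 r0 n0; rewrite one_bit_boundE//; congr (_%:E).
rewrite /one_bit_info; have n1 : (0 : R) < n%:R by rewrite ltr0n.
move: (@pi R) (pi_gt0 R) (n%:R : R) n1 => p p0 k k0.
have ps : 0 < p * sigma ^+ 2 by rewrite mulr_gt0 ?exprn_gt0.
rewrite -[LHS]invrK; congr (_^-1); rewrite invfM invrK.
by field; rewrite gt_eqF//= gt_eqF.
Qed.

Lemma one_bit_bound_asymptotic (R : realType) (sigma r : R) :
  0 < sigma -> 0 <= r ->
  (fun n : nat => fine (one_bit_bound sigma r%:E n) : R^o) =
     (fun n : nat => pi / (2 * n%:R) * sigma ^+ 2 : R^o)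
     +O_\oo (fun n : nat => (n%:R ^- 2) : R^o).
Proof.
move=> s0 r0; apply/eqaddOP.
near=> k; near=> n.
have n0 : (0 < n)%N by near: n; exact: nbhs_infty_gt.
have n1 : (0 : R) < n%:R by rewrite ltr0n.
(* The two expressions differ by [(pi sigma^2)^2 r / (2 n (2 n + pi sigma^2 r))], whose denominator
   is at least [n^2]. *)
have kr : (pi * sigma ^+ 2) ^+ 2 * r <= k.
  by near: k; apply: nbhs_pinfty_ge; rewrite num_real.
rewrite /= !fctE /= one_bit_boundE//= [X in _ <= _ * X]ger0_norm; last first.
  by rewrite invr_ge0 exprn_ge0.
have p0 := pi_gt0 R.
move: (@pi R) p0 kr (n%:R : R) n1 => p p0 kr m m0.
have ps : 0 < p * sigma ^+ 2 by rewrite mulr_gt0 ?exprn_gt0.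
have D0 : 0 < 2 * m + p * sigma ^+ 2 * r.
  by rewrite ltr_pwDl ?mulr_gt0// mulr_ge0// ltW.
have -> : p * sigma ^+ 2 / (2 * m + p * sigma ^+ 2 * r) - p / (2 * m) * sigma ^+ 2 =
    - ((p * sigma ^+ 2) ^+ 2 * r / (2 * m * (2 * m + p * sigma ^+ 2 * r))).
  by field; rewrite !gt_eqF.
rewrite normrN ger0_norm; last first.
  by rewrite divr_ge0 ?mulr_ge0// ?sqr_ge0// ltW.
apply: ler_pM => //; first by rewrite mulr_ge0 ?sqr_ge0.
  by rewrite invr_ge0 !mulr_ge0// ltW.
rewrite lef_pV2 ?posrE ?mulr_gt0 ?exprn_gt0// expr2.
apply: ler_pM => //; [exact: ltW|exact: ltW|lra|].
have : 0 <= p * sigma ^+ 2 * r by rewrite mulr_ge0// ltW.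
lra.
Unshelve. all: by end_near. Qed.

Theorem theorem2 (R : realType) (sigma : R) (sigma_gt0 : 0 < sigma)
    (Theta : set R) (Theta_itv : is_interval Theta) (Theta_cl : closed Theta)
    (prior : probability (measurableTypeR R) R) (dens : R -> R)
    (dens_prior : is_density_on Theta prior dens)
    (dens_ac : locally_absolutely_continuous Theta dens)
    (dens_vanish : vanishes_at_endpoints Theta dens) :
  let I0 := fisher_location prior dens in
  (forall (n : nat), (0 < n)%N ->
   forall (d : measure_display) (T : measurableType d) (P : probability T R)
     (theta : {RV P >-> R}) (X : 'I_n -> {RV P >-> R})
     (M : 'I_n -> T -> bool) (est : n.-tuple bool -> R),
     adaptive_one_bit prior sigma theta X M ->
     (one_bit_bound sigma I0 n <= mean_squared_error theta M est)%E)
  /\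
  ((I0 < +oo)%E ->
   (fun n : nat => fine (one_bit_bound sigma I0 n) : R^o) =
     (fun n : nat => pi / (2 * n%:R) * sigma ^+ 2 : R^o)
     +O_\oo (fun n : nat => (n%:R ^- 2) : R^o)).
Proof.
move=> I0.
have I0_ge0 : (0 <= I0)%E by apply: integral_ge0 => t _; rewrite lee_fin sqr_ge0.
have I0E : (I0 < +oo)%E -> I0 = (fine I0)%:E by move=> ?; rewrite fineK// ge0_fin_numE.
have r0 : 0 <= fine I0 by exact: fine_ge0.
split=> [n n0 d T P theta X M est one_bit|I0y]; last first.
  by rewrite (I0E I0y); exact: one_bit_bound_asymptotic.
have [I0y|] := ltP I0 +oo%E; last first.
  (* Infinite information makes the bound 0, below any mean squared error. *)
  rewrite leye_eq => /eqP ->; rewrite one_bit_bound_pinfty//.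
  rewrite /mean_squared_error unlock.
  by apply: integral_ge0 => w _; rewrite lee_fin sqr_ge0.
have [S mS MS] := encoder_sets one_bit.
rewrite (mean_squared_errorE sigma_gt0 one_bit mS MS) (I0E I0y) one_bit_bound_info//.
apply: (le_trans (van_trees_ereal sigma_gt0 mS Theta_itv Theta_cl dens_prior
  dens_ac dens_vanish (fun m => est (insubd (nseq_tuple n false) m)) n0 I0y)).
(* The two sums agree term by term, since integration against [prior] is Lebesgue integration
   against [ext_dens]. *)
rewrite le_eqVlt; apply/orP; left; apply/eqP; apply: eq_bigr => m _.
set e := est _.
have ml : measurable_fun setT (lik sigma S [::] m) := measurable_lik sigma_gt0 mS m.
have mf : measurable_fun setT (fun x : R => (x - e) ^+ 2 * lik sigma S [::] m x).
  by apply: measurable_funM => //; apply: measurable_funX; exact: measurable_funB.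
have mp := measurable_ext_dens Theta_cl dens_ac dens_vanish.
under [RHS]eq_integral do rewrite -EFinM.
rewrite (@ge0_integral_density _ _ _ lebesgue_measure prior (EFin \o ext_dens Theta dens)).
- by apply: eq_integral => x _; rewrite /= -EFinM mulrA.
- by apply/measurable_EFinP; exact: mp.
- by move=> x; rewrite lee_fin (ext_dens_ge0 dens_prior).
- by move=> B mB; exact: (prior_ext_dens Theta_itv Theta_cl dens_prior mB).
- by move=> x; rewrite lee_fin mulr_ge0 ?sqr_ge0 ?lik_ge0.
- by apply/measurable_EFinP; exact: mf.
Qed.
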